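(* For every dimension $n$ there exists a connected oriented smooth manifold $M$ of dimension $n$ such that, for every complete Riemannian metric $g$ on $M$, every smooth positive measure $d\mu=e^{2h}\,d\mathrm{vol}_g$ on $M$ (with $h\in C^\infty(M)$), and every integer $k\in\{0,1,\dots,n\}$ with $k\neq 0,n$, the natural map $$\mathcal{H}^k_\mu(M)\longrightarrow H^k(M,\mathbb{R}),\qquad \alpha\mapsto[\alpha],$$ is not surjective.
   Context: Let $(M,g)$ be a complete Riemannian manifold, $h\in C^\infty(M)$ and $d\mu=e^{2h}\,d\mathrm{vol}_g$. The space of $L^2_\mu$ $k$-forms is $$L^2_\mu(\Lambda^kT^*M)=\Big\{\alpha\in L^2_{\mathrm{loc}}(\Lambda^kT^*M) : \|\alpha\|_\mu^2:=\int_M|\alpha|^2(x)\,d\mu(x)<\infty\Big\}.$$ Let $d^*$ be the formal adjoint of the exterior derivative $d$ with respect to $d\mathrm{vol}_g$, and let $d^*_\mu=e^{-2h}d^*e^{2h}$, the formal adjoint of $d$ with respect to $\mu$. Define $$\mathcal{H}^k_\mu(M)=\{\alpha\in L^2_\mu(\Lambda^kT^*M) : d\alpha=0,\ d^*_\mu\alpha=0\},$$ where the equations hold in the distributional sense; by elliptic regularity the elements of $\mathcal{H}^k_\mu(M)$ are smooth closed forms. $H^k(M,\mathbb{R})$ is the $k$-th real (de Rham) cohomology group of $M$, and the natural map sends $\alpha$ to its de Rham cohomology class $[\alpha]$. *)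

(* Defs.v *)
(* Smooth manifolds are given by a countable atlas, and every tensor field is
   given by its components in each chart of the atlas, together with the tensor
   transformation law on overlaps.  A field is a family indexed by the charts
   and by the points of R^n; its values outside the image of the chart are
   irrelevant and every condition below ignores them. *)
From HB Require Import structures.
From mathcomp Require Import all_boot all_order all_algebra all_fingroup.
From mathcomp Require Import all_classical all_reals all_analysis.

Set Implicit Arguments.
Unset Strict Implicit.
Unset Printing Implicit Defensive.

Import Order.TTheory GRing.Theory Num.Theory.
Import numFieldNormedType.Exports.

Local Open Scope classical_set_scope.
Local Open Scope ring_scope.

Section borel_rV.
Variables (R : realType) (n : nat).

Let borel_rV : set_system 'rV[R]_n := <<s @open 'rV[R]_n >>.

Let borel_rV0 : borel_rV set0.
Proof. exact: sigma_algebra0. Qed.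

Let borel_rVC A : borel_rV A -> borel_rV (~` A).
Proof. exact: sigma_algebraC. Qed.

Let borel_rV_bigcup (F : (set 'rV[R]_n)^nat) :
  (forall i, borel_rV (F i)) -> borel_rV (\bigcup_i (F i)).
Proof. exact: sigma_algebra_bigcup. Qed.

HB.instance Definition _ := @isMeasurable.Build (sigma_display (@open 'rV[R]_n))
  'rV[R]_n borel_rV borel_rV0 borel_rVC borel_rV_bigcup.

End borel_rV.

Section euclidean.
Variable R : realType.

(* Lebesgue measure on R^n, as the n-fold product of that of R. *)
Fixpoint lebesgue_rV (n : nat) : set 'rV[R]_n -> \bar R :=
  match n with
  | 0%N => \d_(0 : 'rV[R]_0)
  | n'.+1 => pushforward
      ((@lebesgue_measure R) \x (lebesgue_rV (n := n')))%E
      (fun p : measurableTypeR R * 'rV[R]_n' =>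
         row_mx (p.1%:M : 'rV[R]_1) p.2 : 'rV[R]_n'.+1)
  end.

Variable n : nat.

Definition pderiv (i : 'I_n) (f : 'rV[R]_n -> R) : 'rV[R]_n -> R :=
  fun x => 'D_(delta_mx 0 i) f x.

(* C^oo on an open set U : all iterated partial derivatives exist and are
   continuous at every point of U. *)
Definition smooth_on (U : set 'rV[R]_n) (f : 'rV[R]_n -> R) : Prop :=
  forall (s : seq 'I_n) (x : 'rV[R]_n), U x ->
    {for x, continuous (foldr pderiv f s)} /\
    forall i, derivable (foldr pderiv f s) x (delta_mx 0 i).

End euclidean.

(* For a Hausdorff space, having a countable atlas amounts to being second
   countable and locally Euclidean.  [param i] inverts [chart i]; some [dom i]
   may be empty. *)
Record manifold (R : realType) (n : nat) := Manifold {
  carrier :> topologicalType;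
  dom : nat -> set carrier;
  chart : nat -> carrier -> 'rV[R]_n;
  param : nat -> 'rV[R]_n -> carrier;
  carrier_hausdorff : hausdorff_space carrier;
  dom_cover : \bigcup_i dom i = setT;
  dom_open : forall i, open (dom i);
  chart_open : forall i, open (chart i @` dom i);
  chartK : forall i, {in dom i, cancel (chart i) (param i)};
  chart_continuous : forall i, {in dom i, continuous (chart i)};
  param_continuous : forall i, {in chart i @` dom i, continuous (param i)};
  transition_smooth : forall i j l,
    smooth_on (chart i @` (dom i `&` dom j))
      (fun x => chart j (param i x) 0 l)
}.

Arguments dom {R n} m i.
Arguments chart {R n} m i.
Arguments param {R n} m i.

Section geometry.
Variables (R : realType) (n : nat) (M : manifold R n).

Definition cod (i : nat) : set 'rV[R]_n := chart M i @` dom M i.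

Definition overlap (i j : nat) : set 'rV[R]_n :=
  chart M i @` (dom M i `&` dom M j).

Definition transition (i j : nat) (x : 'rV[R]_n) : 'rV[R]_n :=
  chart M j (param M i x).

(* Row-vector convention: the (p, q) entry is the p-th partial derivative of
   the q-th component. *)
Definition tjac (i j : nat) (x : 'rV[R]_n) : 'M[R]_n :=
  jacobian (transition i j) x.

(* The orientation carried by M is the one for which all charts are positive. *)
Definition oriented : Prop :=
  forall i j x, overlap i j x -> 0 < \det (tjac i j x).

Definition smooth_function (h : M -> R) : Prop :=
  forall i, smooth_on (cod i) (h \o param M i).

(* The sets [piece i] form a Borel partition of M with [piece i] included in
   [dom i]. *)
Definition piece (i : nat) : set M := seqDU (dom M) i.

Definition chart_at (m : M) : nat := xget 0%N [set i | piece i m].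

Definition metric_field := nat -> 'rV[R]_n -> 'M[R]_n.

Definition riemannian (g : metric_field) : Prop :=
  [/\ forall i p q, smooth_on (cod i) (fun x => g i x p q),
      forall i x, cod i x -> (g i x)^T = g i x,
      forall i x (v : 'rV[R]_n), cod i x -> v != 0 ->
        0 < (v *m g i x *m v^T) 0 0 &
      forall i j x, overlap i j x ->
        g i x = tjac i j x *m g j (transition i j x) *m (tjac i j x)^T].

(* The length of a curve c is that of its restriction to [0, 1]. *)
Definition smooth_curve (c : R -> M) : Prop :=
  continuous c /\
  forall i l k t, dom M i (c t) ->
    derivable (derive1n k (fun s => chart M i (c s) 0 l)) t 1.

Definition velocity (i : nat) (c : R -> M) (t : R) : 'rV[R]_n :=
  \row_l derive1 (fun s => chart M i (c s) 0 l) t.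

Definition speed (g : metric_field) (c : R -> M) (t : R) : R :=
  let i := chart_at (c t) in
  let v := velocity i c t in
  Num.sqrt ((v *m g i (chart M i (c t)) *m v^T) 0 0).

Definition curve_length (g : metric_field) (c : R -> M) : \bar R :=
  (\int[@lebesgue_measure R]_(t in `[0%R, 1%R]) (speed g c t)%:E)%E.

(* Allowing piecewise smooth curves would not change the infimum: such a curve
   becomes smooth after a reparametrisation that is flat at the corners. *)
Definition riemannian_distance (g : metric_field) (x y : M) : \bar R :=
  ereal_inf [set curve_length g c |
             c in [set c | [/\ smooth_curve c, c 0 = x & c 1 = y]]].

Definition complete_metric (g : metric_field) : Prop :=
  forall u : nat -> M,
    (forall e : R, 0 < e -> exists N : nat, forall p q : nat,
       (N <= p)%N -> (N <= q)%N ->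
       (riemannian_distance g (u p) (u q) < e%:E)%E) ->
    exists x : M, riemannian_distance g (u p) x @[p --> \oo] --> 0%E.

(* Integral over M of a scalar field against dvol_g = sqrt (det g) dx. *)
Definition integral_vol (g : metric_field) (f : nat -> 'rV[R]_n -> R) : \bar R :=
  (\sum_(0 <= i <oo) \int[@lebesgue_rV R n]_(x in chart M i @` piece i)
     (f i x * Num.sqrt (\det (g i x)))%:E)%E.

(* Density e^{2h} of mu with respect to dvol_g. *)
Definition weight (h : M -> R) (i : nat) (x : 'rV[R]_n) : R :=
  expR (2 * h (param M i x)).

Definition integral_mu (g : metric_field) (h : M -> R)
    (f : nat -> 'rV[R]_n -> R) : \bar R :=
  integral_vol g (fun i x => weight h i x * f i x).

Section forms.
Variable k : nat.

(* For I = (i_1, ..., i_k), the component of alpha of multi-index I is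
   alpha (d/dx_{i_1}, ..., d/dx_{i_k}); all k-tuples are allowed, not only the
   increasing ones. *)
Definition form_field := nat -> 'rV[R]_n -> {ffun 'I_k -> 'I_n} -> R.

Definition is_form (a : form_field) : Prop :=
  (forall i x (I : {ffun 'I_k -> 'I_n}) (s : 'S_k), cod i x ->
     a i x [ffun p => I (s p)] = (-1) ^+ s * a i x I) /\
  (forall i j x (I : {ffun 'I_k -> 'I_n}), overlap i j x ->
     a i x I = \sum_(J : {ffun 'I_k -> 'I_n})
                 (\prod_(p < k) tjac i j x (I p) (J p)) *
                 a j (transition i j x) J).

Definition smooth_form (a : form_field) : Prop :=
  is_form a /\ forall i I, smooth_on (cod i) (fun x => a i x I).

Definition zero_form : form_field := fun _ _ _ => 0.

Definition sub_form (a b : form_field) : form_field :=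
  fun i x I => a i x I - b i x I.

Definition scale_form (w : nat -> 'rV[R]_n -> R) (a : form_field) : form_field :=
  fun i x I => w i x * a i x I.

Definition eq_form (a b : form_field) : Prop :=
  forall i x I, cod i x -> a i x I = b i x I.

Definition ae_eq_form (a b : form_field) : Prop :=
  forall i I, {ae @lebesgue_rV R n, forall x, cod i x -> a i x I = b i x I}.

Definition compactly_supported (a : form_field) : Prop :=
  exists2 K : set M, compact K &
    forall i x I, cod i x -> ~ K (param M i x) -> a i x I = 0.

(* The factor 1 / k! compensates for the sum over all k-tuples, so that the
   wedge products of an orthonormal coframe are orthonormal. *)
Definition form_inner (g : metric_field) (a b : form_field)
    (i : nat) (x : 'rV[R]_n) : R :=
  (k`!%:R)^-1 *
  \sum_(I : {ffun 'I_k -> 'I_n}) \sum_(J : {ffun 'I_k -> 'I_n})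
    (\prod_(p < k) invmx (g i x) (I p) (J p)) * a i x I * b i x J.

(* Forms in L^2_loc are represented by Borel functions obeying the
   transformation law everywhere; they are identified up to [ae_eq_form]. *)
Definition L2_loc (a : form_field) : Prop :=
  [/\ is_form a,
      forall i I, measurable_fun (cod i) (fun x => a i x I) &
      forall i I (K : set 'rV[R]_n), compact K -> K `<=` cod i ->
        (\int[@lebesgue_rV R n]_(x in K) (a i x I ^+ 2)%:E < +oo)%E].

Definition L2_mu (g : metric_field) (h : M -> R) (a : form_field) : Prop :=
  L2_loc a /\ (integral_mu g h (form_inner g a a) < +oo)%E.

(* [face I p] omits the p-th entry of I. *)
Definition face (I : {ffun 'I_k.+1 -> 'I_n}) (p : 'I_k.+1) :
  {ffun 'I_k -> 'I_n} := [ffun q => I (lift p q)].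

End forms.

Definition ext_d (k : nat) (a : form_field k) : form_field k.+1 :=
  fun i x I => \sum_(p < k.+1)
    (-1) ^+ p * pderiv (I p) (fun y => a i y (face I p)) x.

(* da = b in the sense of distributions: componentwise in each chart, the
   derivatives being transferred to a test function. *)
Definition weak_d (k : nat) (a : form_field k) (b : form_field k.+1) : Prop :=
  forall (i : nat) (I : {ffun 'I_k.+1 -> 'I_n}) (phi : 'rV[R]_n -> R),
    smooth_on setT phi ->
    (exists2 K : set 'rV[R]_n, compact K /\ K `<=` cod i &
       forall x, ~ K x -> phi x = 0) ->
    (\int[@lebesgue_rV R n]_(x in cod i) (b i x I * phi x)%:E =
     - \int[@lebesgue_rV R n]_(x in cod i)
         (\sum_(p < k.+1) (-1) ^+ p * a i x (face I p) * pderiv (I p) phi x)%:E)%E.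

(* d^* a = b in the sense of distributions, d^* being the formal adjoint of d
   for dvol_g. *)
Definition weak_codiff (g : metric_field) (k : nat)
    (a : form_field k.+1) (b : form_field k) : Prop :=
  forall c : form_field k, smooth_form c -> compactly_supported c ->
    integral_vol g (form_inner g b c) = integral_vol g (form_inner g a (ext_d c)).

(* d^*_mu a = b for d^*_mu = e^{-2h} d^* e^{2h}, in the sense of
   distributions. *)
Definition weak_codiff_mu (g : metric_field) (h : M -> R) (k : nat)
    (a : form_field k.+1) (b : form_field k) : Prop :=
  weak_codiff g (scale_form (weight h) a) (scale_form (weight h) b).

Definition weakly_closed (k : nat) (a : form_field k) : Prop :=
  weak_d a (@zero_form k.+1).

Definition weakly_coclosed (g : metric_field) (h : M -> R) (k : nat) :
    form_field k -> Prop :=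
  match k with
  | 0%N => fun=> True
  | k'.+1 => fun a => weak_codiff_mu g h a (@zero_form k')
  end.

Definition harmonic_space (g : metric_field) (h : M -> R) (k : nat) :
    set (form_field k) :=
  [set a | [/\ L2_mu g h a, weakly_closed a & weakly_coclosed g h a]].

Definition closed_form (k : nat) : set (form_field k) :=
  [set a | smooth_form a /\ eq_form (ext_d a) (@zero_form k.+1)].

Definition exact_form (k : nat) : set (form_field k) :=
  match k with
  | 0%N => [set a | eq_form a (@zero_form 0)]
  | k'.+1 => [set a | exists2 b : form_field k',
                        smooth_form b & eq_form a (ext_d b)]
  end.

Definition deRham_class (k : nat) (a : form_field k) : set (form_field k) :=
  [set b | closed_form b /\ exact_form (sub_form b a)].

(* The cohomology group is the set of cohomology classes of closed forms. *)
Definition deRham_cohomology (k : nat) : set (set (form_field k)) :=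
  @deRham_class k @` @closed_form k.

(* The class of an L^2 form is that of its smooth representative, which by
   elliptic regularity exists for all elements of [harmonic_space]. *)
Definition natural_map (k : nat) (a : form_field k) : set (form_field k) :=
  [set b | exists a' : form_field k,
             [/\ closed_form a', ae_eq_form a a' & deRham_class a' b]].

End geometry.

Arguments harmonic_space {R n M} g h k.
Arguments deRham_cohomology {R n} M k.
Arguments natural_map {R n} M k.

(* Main.v *)
(* H^k is made so large that no L^2 bound can hold on all classes.  M is R^n with countably many disjoint closed holes removed; the j-th hole relevant to degree k is the product of k + 1 intervals and R^(n-k-1), so that it is linked with a k-sphere.  Cutting off the hole gives a compactly supported closed (n-k)-form on M: up to sign it is d(phi), wedged with dx_(k+1), ..., dx_(n-1), where phi is a product of plateau functions constant near the relevant part of the hole.  Integration against it is a functional L_j on closed k-forms that vanishes on exact forms (Stokes), and a pointwise Cauchy-Schwarz inequality bounds 2 L_j(alpha) by |alpha|_mu^2 + D_j with D_j depending only on g, h and j.  Conversely closed forms concentrated along half spaces leaving the holes realize all sequences of values (L_j)_j, and a class with 2 L_j > D_j + j for all j contains no L^2 form, harmonic or not. *)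
Require Import Defs.
From HB Require Import structures.
From mathcomp Require Import all_boot all_order all_algebra all_fingroup.
From mathcomp Require Import all_classical all_reals all_analysis.
From mathcomp Require Import measurable_realfun ring lra zify.

Set Implicit Arguments.
Unset Strict Implicit.
Unset Printing Implicit Defensive.

Import Order.TTheory GRing.Theory Num.Theory.
Import numFieldNormedType.Exports.

Local Open Scope classical_set_scope.
Local Open Scope ring_scope.

(** The manifold is fixed before [g] and [h], so the constants D_j are unknown when the holes are
    cut. The class is chosen after them, and the squared norm of a form is one finite number that
    would have to dominate an unbounded sequence. Numbering the holes by [m] and shaping the m-th by
    [m %% n] gives every degree strictly between 0 and n infinitely many holes in one and the same
    manifold. Since M is open in R^n and has a single nonempty chart, Stokes reduces to Fubini and
    the fundamental theorem of calculus along coordinate lines. No wedge product of forms is formed: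
    L_j is an alternating sum over the faces of the multi-index (0, ..., k), with partial
    derivatives of a cutoff as coefficients. An element of [harmonic_space] is only a Borel form.
    The estimate is therefore proved for arbitrary component functions with integrable pairing, and
    cohomology enters through a smooth closed representative equal to the form almost everywhere.
    Half-widths: holes and bumps 1, plateaus 2 (constant part) and 3 (support). The spacing 8 keeps
    the neighbourhoods of different holes apart. *)

Section pointwise_continuity.
Variables (R : realType) (T : topologicalType).
Implicit Types (f g : T -> R) (x : T).

Lemma cont_add f g x : continuous_at x f -> continuous_at x g ->
  continuous_at x (fun y => f y + g y).
Proof. exact: cvgD. Qed.

Lemma cont_sub f g x : continuous_at x f -> continuous_at x g ->
  continuous_at x (fun y => f y - g y).
Proof. exact: cvgB. Qed.

Lemma cont_mul f g x : continuous_at x f -> continuous_at x g ->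
  continuous_at x (fun y => f y * g y).
Proof. exact: cvgM. Qed.

Lemma cont_inv f x :
  f x != 0 -> continuous_at x f -> continuous_at x (fun y => (f y)^-1).
Proof. by move=> fx cf; exact: cvgV. Qed.

Lemma cont_near f g x (V : set T) :
  nbhs x V -> (forall y, V y -> f y = g y) -> continuous_at x g -> continuous_at x f.
Proof.
move=> xV fg cg; rewrite /continuous_at (fg x (nbhs_singleton xV)).
have e : \forall y \near x, g y = f y by apply: filterS xV => y /fg.
exact: (cvg_trans (near_eq_cvg e) cg).
Qed.

Lemma cont_norm f x : continuous_at x f -> continuous_at x (fun y => `|f y|).
Proof. exact: cvg_norm. Qed.

Lemma cont_sum (I : Type) (r : seq I) (P : pred I) (F : I -> T -> R) x :
  (forall i, P i -> continuous_at x (F i)) ->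
  continuous_at x (fun y => \sum_(i <- r | P i) F i y).
Proof.
move=> cF; elim: r => [|i r IH]; rewrite /continuous_at.
  by rewrite big_nil; under eq_fun do rewrite big_nil; exact: cvg_cst.
rewrite big_cons; under eq_fun do rewrite big_cons; case: ifP => // Pi.
by apply: cvgD IH; exact: cF.
Qed.

Lemma cont_prod (I : Type) (r : seq I) (P : pred I) (F : I -> T -> R) x :
  (forall i, P i -> continuous_at x (F i)) ->
  continuous_at x (fun y => \prod_(i <- r | P i) F i y).
Proof.
move=> cF; elim: r => [|i r IH]; rewrite /continuous_at.
  by rewrite big_nil; under eq_fun do rewrite big_nil; exact: cvg_cst.
rewrite big_cons; under eq_fun do rewrite big_cons; case: ifP => // Pi.
by apply: cvgM IH; exact: cF.
Qed.

End pointwise_continuity.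

(** * Topology and Borel sets of R^n *)

Section rV_topology.
Variables (R : realType) (n : nat).
Implicit Types (x y : 'rV[R]_n) (A O : set 'rV[R]_n).

Lemma nbhs_rVP x A :
  nbhs x A <-> exists2 e : R, 0 < e & forall y, (forall i, `|x 0 i - y 0 i| < e) -> A y.
Proof.
split=> [/nbhs_ballP[e /= e0 eA]|[e e0 eA]].
  by exists e => // y xy; apply: eA; split=> // i j; rewrite (ord1 i); exact: xy.
by apply/nbhs_ballP; exists e => //= y [_ xy]; apply: eA => i; exact: xy.
Qed.

Definition cube x (r : R) : set 'rV[R]_n := [set y | forall i, `|x 0 i - y 0 i| <= r].

Lemma closed_cube x r : closed (cube x r).
Proof.
rewrite (_ : cube x r = \bigcap_(i in [set: 'I_n])
    ((fun y : 'rV[R]_n => `|x 0 i - y 0 i|) @^-1` [set t | t <= r])); last first.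
  by apply/seteqP; split=> y xy => [i _|i]; [exact: (xy i)|exact: (xy i I)].
apply: closed_bigI => i _; apply: closed_comp; last exact: closed_le.
by move=> y _; apply: cont_norm; apply: cont_sub; [exact: cst_continuous|exact: coord_continuous].
Qed.

(** The factor [[set _ | ...]] is all or nothing: it keeps exactly the rational cubes contained in
    O, so that the union runs over a countable type. *)
Lemma open_countable_cubes O : open O ->
  O = \bigcup_(p : 'rV[rat]_n * nat)
        (cube (map_mx ratr p.1) p.2.+1%:R^-1 `&`
         [set _ | cube (map_mx ratr p.1) p.2.+1%:R^-1 `<=` O]).
Proof.
move=> oO; apply/seteqP; split=> [x Ox|x [p _ [xp /= pO]]]; last exact: pO.
have /nbhs_rVP[e e0 eO] : nbhs x O by apply: open_nbhs_nbhs.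
(* A cube of radius below e / 2 that contains x stays within e of x. *)
pose k := Num.truncn (2 / e).
have ke : k.+1%:R^-1 < e / 2.
  rewrite -[e / 2]invrK ltf_pV2 ?posrE ?invr_gt0 ?divr_gt0// invf_div.
  exact: truncnS_gt.
have k0 : 0 < k.+1%:R^-1 :> R by rewrite invr_gt0.
have q i : {q : rat | `|ratr q - x 0 i| <= k.+1%:R^-1}.
  apply: cid; have [|q] := @rat_in_itvoo R (x 0 i) (x 0 i + k.+1%:R^-1).
    by rewrite ltrDl.
  rewrite in_itv /= => /andP[q1 q2]; exists q.
  by rewrite ger0_norm ?subr_ge0 ?ltW// ltrBlDl.
pose Q := \row_i sval (q i).
have xQ : cube (map_mx ratr Q) k.+1%:R^-1 x.
  by move=> i; rewrite !mxE; exact: (svalP (q i)).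
exists (Q, k) => //; split=> // y /= Qy; apply: eO => i.
have := xQ i; have := Qy i; rewrite !mxE => h1 h2.
have -> : x 0 i - y 0 i = (ratr (sval (q i)) - y 0 i) - (ratr (sval (q i)) - x 0 i) by ring.
apply: le_lt_trans (ler_normB _ _) _; apply: le_lt_trans (lerD h1 h2) _.
by rewrite [ltRHS]splitr ltrD.
Qed.

Lemma open_measurable_rV O : open O -> measurable O.
Proof. exact: sub_sigma_algebra. Qed.

Lemma closed_measurable_rV A : closed A -> measurable A.
Proof.
move=> cA; rewrite -(setCK A); apply: measurableC.
by apply: open_measurable_rV; exact: closed_openC.
Qed.

Lemma measurable_fun_open_continuous O (f : 'rV[R]_n -> R) : open O ->
  (forall x, O x -> continuous_at x f) -> measurable_fun O f.
Proof.
move=> oO cf mO; apply: (measurability _ (RGenOInfty.measurableE R)) => //=.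
move=> _ [_ [a ->] <-]; apply: open_measurable_rV.
rewrite openE => x [Ox /= fx]; apply: filterI; first exact: open_nbhs_nbhs.
by apply: cf => //; apply: open_nbhs_nbhs; split => //; exact: interval_open.
Qed.

(** An open set is a countable union of cubes, and a cube is cut out by finitely many conditions on
    single coordinates. *)
Lemma measurable_fun_rV d (T : measurableType d) (f : T -> 'rV[R]_n) :
  (forall i, measurable_fun setT (fun t => f t 0 i)) -> measurable_fun setT f.
Proof.
move=> mf; apply: (@measurability _ _ _ _ _ _ (@open 'rV[R]_n)) => //.
move=> _ [B oB <-]; rewrite setTI (open_countable_cubes oB) preimage_bigcup.
apply: countable_bigcupT_measurable => [|[q k] /=]; first exact: countableP.
rewrite preimage_setI.
have [qB|qB] := pselect (cube (map_mx ratr q) k.+1%:R^-1 `<=` B); last first.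
  rewrite [X in _ `&` X](_ : _ = set0) ?setI0//.
  by apply/seteqP; split.
rewrite [X in _ `&` X](_ : _ = setT) ?setIT//; last by apply/seteqP; split.
rewrite (_ : _ @^-1` _ = \big[setI/setT]_(i < n)
    ((fun t => `|map_mx ratr q 0 i - f t 0 i|) @^-1` `]-oo, k.+1%:R^-1])); last first.
  rewrite -(bigcap_seq (index_enum 'I_n)); apply/seteqP.
  split=> t /= ft i; first by move=> _ /=; rewrite in_itv /=; exact: ft.
  by have := ft i; rewrite /= in_itv /=; apply; exact: mem_index_enum.
apply: bigsetI_measurable => i _; rewrite -[X in measurable X]setTI.
have /(_ measurableT) : measurable_fun setT (fun t => `|map_mx ratr q 0 i - f t 0 i|);
  last by apply.
apply: (@measurableT_comp _ _ _ _ _ _ (@Num.norm R R)) => //=.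
exact: (measurable_funB (measurable_cst _) (mf i)).
Qed.

End rV_topology.

(** * Lebesgue measure on R^n *)

Section rV_cons.
Variables (R : realType) (n : nat).

Definition consrv (t : R) (y : 'rV[R]_n) : 'rV[R]_n.+1 := row_mx (t%:M : 'rV[R]_1) y.

Lemma consrv0 t y : consrv t y 0 ord0 = t.
Proof.
have -> : (ord0 : 'I_n.+1) = lshift n (ord0 : 'I_1) by apply: val_inj.
by rewrite /consrv (row_mxEl (t%:M : 'rV[R]_1)) mxE eqxx mulr1n.
Qed.

Lemma consrvS t y j : consrv t y 0 (lift ord0 j) = y 0 j.
Proof.
have -> : lift ord0 j = rshift 1 j by apply: val_inj.
by rewrite /consrv (row_mxEr (t%:M : 'rV[R]_1)).
Qed.

Lemma measurable_consrv :
  measurable_fun setT (fun p : measurableTypeR R * 'rV[R]_n => consrv p.1 p.2).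
Proof.
apply: measurable_fun_rV => i; have [j ->|->] := unliftP ord0 i.
  under eq_fun do rewrite consrvS.
  apply: (@measurableT_comp _ _ _ _ _ _ (fun y : 'rV[R]_n => y 0 j)) => //.
  apply: measurable_fun_open_continuous => [|x _]; first exact: openT.
  exact: coord_continuous.
by under eq_fun do rewrite consrv0; exact: measurable_fst.
Qed.

Lemma preimage_consrv_cube (r : R) :
  (fun p : measurableTypeR R * 'rV[R]_n => consrv p.1 p.2) @^-1` cube 0 r =
  `[- r, r] `*` cube 0 r.
Proof.
apply/seteqP; split=> -[t y] /=.
  move=> h; split=> [|i]; last by have := h (lift ord0 i); rewrite consrvS !mxE.
  by have := h ord0; rewrite consrv0 !mxE sub0r normrN in_itv /= ler_norml.
move=> [/= tr yr] i; have [j ->|->] := unliftP ord0 i.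
  by rewrite consrvS; have := yr j; rewrite !mxE.
by rewrite consrv0 !mxE sub0r normrN ler_norml; move: tr; rewrite in_itv.
Qed.

End rV_cons.

Lemma bigcup_cube (R : realType) n : \bigcup_(k : nat) cube (0 : 'rV[R]_n) k%:R = setT.
Proof.
apply/seteqP; split=> // x _; exists (Num.truncn (\sum_i `|x 0 i|)).+1 => //= i.
rewrite mxE sub0r normrN; apply: le_trans (ltW (truncnS_gt _)).
by rewrite (bigD1 i) //= lerDl sumr_ge0.
Qed.

(** The product with [lebesgue_rV n] is a measure only once [lebesgue_rV n] is known to be a
    sigma-finite one, so all properties go through the same induction. Finiteness on cubes is
    carried along because it yields sigma-finiteness at the next stage. *)
Lemma lebesgue_rV_spec (R : realType) n :
  [/\ @lebesgue_rV R n set0 = 0%E, forall A, (0 <= @lebesgue_rV R n A)%E,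
      semi_sigma_additive (@lebesgue_rV R n), sigma_finite setT (@lebesgue_rV R n) &
      forall r, (@lebesgue_rV R n (cube 0 r) < +oo)%E].
Proof.
have sf m (mu : {measure set 'rV[R]_m -> \bar R}) :
    (forall r, mu (cube 0 r) < +oo)%E -> sigma_finite setT mu.
  move=> fin; exists (fun k => cube 0 k%:R); first by rewrite bigcup_cube.
  by move=> k; split; [apply: closed_measurable_rV; exact: closed_cube|exact: fin].
have step m (mu : {sigma_finite_measure set 'rV[R]_m -> \bar R}) :
    (forall r, mu (cube 0 r) < +oo)%E ->
    let nu := pushforward (lebesgue_measure \x mu)%E
      (fun p : measurableTypeR R * 'rV[R]_m => consrv p.1 p.2) in
    [/\ nu set0 = 0%E, forall A, (0 <= nu A)%E, semi_sigma_additive nu,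
        sigma_finite setT nu & forall r, (nu (cube 0 r) < +oo)%E].
  move=> mfin.
  pose nu := measure_function_pushforward__canonical__measure_function_Measure
    (lebesgue_measure \x mu)%E (@measurable_consrv R m).
  have fin r : (nu (cube 0 r) < +oo)%E.
    rewrite /nu /= /pushforward preimage_consrv_cube product_measure1E //; last first.
      by apply: closed_measurable_rV; exact: closed_cube.
    rewrite lte_mul_pinfty ?mfin//= lebesgue_measure_itv //=.
    by case: ifP => // _; rewrite -EFinB.
  split.
  - exact: (measure0 nu).
  - exact: (measure_ge0 nu).
  - exact: (@measure_semi_sigma_additive _ _ _ nu).
  - exact: (sf _ nu).
  - exact: fin.
elim: n => [|n [m0 mge0 msa msf mfin]] /=.
  pose nu : {measure set 'rV[R]_0 -> \bar R} := \d_(0%R : 'rV[R]_0).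
  have fin r : (nu (cube 0 r) < +oo)%E by rewrite /nu /= diracE ltry.
  split=> //.
  - exact: (@measure_semi_sigma_additive _ _ _ nu).
  - exact: (sf _ nu).
pose mM := isMeasure.Build _ _ _ (@lebesgue_rV R n) m0 mge0 msa.
pose mu0 : {measure set 'rV[R]_n -> \bar R} := HB.pack (@lebesgue_rV R n) mM.
pose mS := Measure_isSigmaFinite.Build _ _ _ mu0 msf.
pose mu : {sigma_finite_measure set 'rV[R]_n -> \bar R} := HB.pack (@lebesgue_rV R n) mM mS.
exact: (step n mu mfin).
Qed.

Section lebesgue_rV_measure.
Variables (R : realType) (n : nat).

Let lebesgue_rV0 : @lebesgue_rV R n set0 = 0%E.
Proof. by case: (lebesgue_rV_spec R n). Qed.

Let lebesgue_rV_ge0 A : (0 <= @lebesgue_rV R n A)%E.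
Proof. by case: (lebesgue_rV_spec R n). Qed.

Let lebesgue_rV_sigma_additive : semi_sigma_additive (@lebesgue_rV R n).
Proof. by case: (lebesgue_rV_spec R n). Qed.

HB.instance Definition _ := isMeasure.Build _ _ _ (@lebesgue_rV R n)
  lebesgue_rV0 lebesgue_rV_ge0 lebesgue_rV_sigma_additive.

Let lebesgue_rV_sigma_finite : sigma_finite setT (@lebesgue_rV R n).
Proof. by case: (lebesgue_rV_spec R n). Qed.

HB.instance Definition _ := @Measure_isSigmaFinite.Build _ _ _ (@lebesgue_rV R n)
  lebesgue_rV_sigma_finite.

Lemma lebesgue_rV_cube r : (@lebesgue_rV R n (cube 0 r) < +oo)%E.
Proof. by case: (lebesgue_rV_spec R n). Qed.

End lebesgue_rV_measure.

(** * Derivatives along lines *)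

Section line_derivative.
Variables (R : realType) (V W : normedModType R).

Lemma derive_along (f : V -> W) (a v : V) (V' : normedModType R) (g : V' -> W) (b w : V') :
  (forall h : R, f (h *: v + a) = g (h *: w + b)) ->
  (derivable f a v <-> derivable g b w) /\ 'D_v f a = 'D_w g b.
Proof.
move=> fg; have fa : f a = g b by have := fg 0; rewrite !scale0r !add0r.
have E : (fun h => h^-1 *: ((f \o shift a) (h *: v) - f a)) =
         (fun h => h^-1 *: ((g \o shift b) (h *: w) - g b)).
  by apply/funext => h /=; rewrite fg fa.
by rewrite /derivable /derive E.
Qed.

End line_derivative.

Section integrable_bounded_support.
Local Open Scope ereal_scope.

Lemma integrable_bounded_support d (T : measurableType d) (R : realType)
    (mu : {measure set T -> \bar R}) (D A : set T) (f : T -> R) :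
  measurable D -> measurable A -> A `<=` D -> mu A < +oo -> measurable_fun D f ->
  [bounded f x | x in A]%R -> (forall x, D x -> ~ A x -> f x = 0%R) ->
  mu.-integrable D (EFin \o f).
Proof.
move=> mD mA AD muA mf bf f0; apply/(integrable_mkcond _ mD).
have -> : (EFin \o f) \_ D = (EFin \o f) \_ A.
  apply/funext => x; rewrite !patchE; have [xA|xA] := boolP (x \in A).
    by rewrite mem_set//; apply/AD/set_mem.
  by case: ifPn => // /set_mem Dx; rewrite /= f0// => Ax; move: xA; rewrite mem_set.
apply/(integrable_mkcond _ mA); apply: measurable_bounded_integrable => //.
exact: measurable_funS mf.
Qed.

End integrable_bounded_support.

(** * Fubini's theorem on R^n *)

Section integral_rV_cons.
Variables (R : realType) (n : nat).
Local Notation leb := (@lebesgue_measure R).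
Local Notation lrv := (@lebesgue_rV R n).
Implicit Types (f : 'rV[R]_n.+1 -> R).

Lemma measurable_fun_continuous m (f : 'rV[R]_m -> R) :
  (forall x, continuous_at x f) -> measurable_fun setT f.
Proof.
by move=> cf; apply: measurable_fun_open_continuous => [|x _]; [exact: openT|exact: cf].
Qed.

Lemma compact_cube m (x : 'rV[R]_m) r : compact (cube x r).
Proof.
apply: bounded_closed_compact; last exact: closed_cube.
exists (`|x| + `|r|); split; first exact: num_real.
move=> M xrM y ry; apply/ltW/(le_lt_trans _ xrM).
rewrite -[leLHS]/(mx_norm y) mx_normrE; apply/bigmax_leP; split; first exact: addr_ge0.
move=> [i j] _ /=; rewrite (ord1 i).
have -> : y 0 j = x 0 j - (x 0 j - y 0 j) by ring.
apply: le_trans (ler_normB _ _) _; apply: lerD.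
  rewrite -[leRHS]/(mx_norm x) mx_normrE.
  exact: (le_bigmax _ (fun ij => `|x ij.1 ij.2|) (0, j)).
exact: le_trans (ry j) (ler_norm r).
Qed.

Lemma continuous_cube_bounded m (f : 'rV[R]_m -> R) r :
  (forall x, continuous_at x f) -> exists B : R, forall x, cube 0 r x -> `|f x| <= B.
Proof.
move=> cf.
have /compact_bounded[M [_ MB]] : compact (f @` cube 0 r).
  apply: continuous_compact; last exact: compact_cube.
  exact: continuous_subspaceT.
by exists (M + 1) => x rx; apply: MB; [rewrite ltrDl|exists x].
Qed.

Lemma integrable_consrv f r : (forall x, continuous_at x f) ->
  (forall x, ~ cube 0 r x -> f x = 0) ->
  (leb \x lrv)%E.-integrable setT
     (fun p : measurableTypeR R * 'rV[R]_n => (f (consrv p.1 p.2))%:E).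
Proof.
move=> cf f0; have [B fB] := continuous_cube_bounded r cf.
apply: (@integrable_bounded_support _ _ _ (leb \x lrv)%E setT (`[(- r)%R, r] `*` cube 0 r)
  (fun p : measurableTypeR R * 'rV[R]_n => f (consrv p.1 p.2))) => //.
- by apply: measurableX => //; apply: closed_measurable_rV; exact: closed_cube.
- rewrite [X in (X < _)%E]product_measure1E //; last first.
    by apply: closed_measurable_rV; exact: closed_cube.
  rewrite lte_mul_pinfty ?lebesgue_rV_cube//= lebesgue_measure_itv //=.
  by case: ifP => // _; rewrite -EFinB.
- apply: (measurableT_comp (f := f)); last exact: measurable_consrv.
  exact: measurable_fun_continuous.
- exists B; split; first exact: num_real.
  move=> M BM p; rewrite -preimage_consrv_cube => /= rp.
  exact: le_trans (fB _ rp) (ltW BM).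
- by move=> p _; rewrite -preimage_consrv_cube => /= rp; exact: f0.
Qed.

(** Both orders are needed: a partial derivative is integrated first over the factor that contains
    its direction. *)
Lemma integral_consrv f r : (forall x, continuous_at x f) ->
  (forall x, ~ cube 0 r x -> f x = 0) ->
  (\int[@lebesgue_rV R n.+1]_x (f x)%:E =
   \int[leb]_t \int[lrv]_y (f (consrv t y))%:E)%E /\
  (\int[@lebesgue_rV R n.+1]_x (f x)%:E =
   \int[lrv]_y \int[leb]_t (f (consrv t y))%:E)%E.
Proof.
move=> cf f0; have int := integrable_consrv cf f0.
have mf : measurable_fun setT (EFin \o f).
  by apply/measurable_EFinP; exact: measurable_fun_continuous.
have := @integral_pushforward _ _ _ _ _ _ (@measurable_consrv R n) (leb \x lrv)%E
  setT (EFin \o f) mf int measurableT.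
rewrite preimage_setT => E; split.
  exact: (etrans E (esym (integral12_prod_meas1 int))).
exact: (etrans E (esym (integral21_prod_meas1 int))).
Qed.

Lemma ge0_integral_consrv f : (forall x, continuous_at x f) -> (forall x, 0 <= f x) ->
  (\int[@lebesgue_rV R n.+1]_x (f x)%:E =
   \int[leb]_t \int[lrv]_y (f (consrv t y))%:E)%E.
Proof.
move=> cf f0.
have mf : measurable_fun setT (EFin \o f).
  by apply/measurable_EFinP; exact: measurable_fun_continuous.
have f0' : {in setT, forall x, (0 <= (EFin \o f) x)%E} by move=> x _; rewrite lee_fin.
have := @ge0_integral_pushforward _ _ _ _ _ _ (@measurable_consrv R n) (leb \x lrv)%E
  setT (EFin \o f) measurableT mf f0'.
rewrite preimage_setT => E; apply: (etrans E).
apply: (@fubini_tonelli1 _ _ _ _ _ leb lrv) => [|x]; last by rewrite lee_fin.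
exact: (measurableT_comp mf (@measurable_consrv R n)).
Qed.

End integral_rV_cons.

Lemma integral_derive0 (R : realType) (G : R -> R) (r : R) :
  (forall t, derivable G t 1) -> continuous (derive1 G) ->
  (forall t, r < `|t| -> G t = 0) ->
  (\int[@lebesgue_measure R]_t (derive1 G t)%:E = 0)%E.
Proof.
move=> dG cG' G0.
have G'0 t : r < `|t| -> derive1 G t = 0.
  move=> rt; rewrite derive1E -(@derive_cst _ R^o R^o 0 t 1).
  apply: near_eq_derive.
  have : nbhs t ((fun s => `|s|) @^-1` [set s | r < s]).
    exact: (@norm_continuous R R^o t _ (lt_nbhsr rt)).
  by apply: filterS => s; exact: G0.
(* The absolute value covers negative r; adding 1 puts the endpoints where G is already 0. *)
pose b := `|r| + 1.
have b0 : - b < b by rewrite gtrN // ltr_pwDr.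
have rb t : b <= `|t| -> r < `|t|.
  by move=> bt; apply: lt_le_trans bt; rewrite (le_lt_trans (ler_norm r))// ltrDl.
have -> : (\int[@lebesgue_measure R]_t (derive1 G t)%:E =
    \int[@lebesgue_measure R]_(t in `[(- b)%R, b]) (derive1 G t)%:E)%E.
  rewrite [RHS]integral_mkcond; apply: eq_integral => t _; rewrite patchE.
  case: ifPn => // /negP tb; rewrite G'0// rb// leNgt; apply/negP => /ltW.
  by rewrite ler_norml => tb'; apply: tb; rewrite inE /= in_itv.
have cG : continuous G.
  by move=> t; apply: differentiable_continuous; exact/derivable1_diffP.
rewrite (continuous_FTC2 (F := G)) //.
- by rewrite !G0 ?subee// rb// ?normrN ler_norm.
- exact: continuous_subspaceT.
- split; first by move=> t _.
  + by apply: cvg_at_right_filter; exact: cG.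
  + by apply: cvg_at_left_filter; exact: cG.
Qed.

(** * Integrals of partial derivatives and of products *)

Section partial_derivative.
Variables (R : realType).

Lemma continuous_rV (T : topologicalType) n (f : T -> 'rV[R]_n) x :
  (forall i, continuous_at x (fun t => f t 0 i)) -> continuous_at x f.
Proof.
move=> cf A /nbhs_rVP[e e0 eA].
have : \forall t \near x, forall i, `|f x 0 i - f t 0 i| < e.
  apply: filter_forall => i.
  have := @cvgr_dist_lt _ _ _ _ _ _ _ (cf i) e e0.
  by apply.
by apply: filterS => t; exact: eA.
Qed.

Lemma continuous_consrvl n (y : 'rV[R]_n) : continuous (fun t => consrv t y).
Proof.
move=> t; apply: continuous_rV => i; have [j ->|->] := unliftP ord0 i.
  by under eq_fun do rewrite consrvS; exact: cst_continuous.
by under eq_fun do rewrite consrv0; exact: cvg_id.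
Qed.

Lemma continuous_consrvr n (t : R) : continuous (fun y : 'rV[R]_n => consrv t y).
Proof.
move=> y; apply: continuous_rV => i; have [j ->|->] := unliftP ord0 i.
  by under eq_fun do rewrite consrvS; exact: coord_continuous.
by under eq_fun do rewrite consrv0; exact: cst_continuous.
Qed.

Lemma consrv_shift0 n (h t : R) (y : 'rV[R]_n) :
  h *: delta_mx 0 ord0 + consrv t y = consrv (h + t) y.
Proof.
apply/rowP => i; rewrite [LHS]mxE [X in X + _]mxE [X in _ * X]mxE eqxx /=.
have [j ->|->] := unliftP ord0 i; last by rewrite !consrv0 mulr1.
by rewrite !consrvS eq_sym (negbTE (neq_lift _ _)) mulr0 add0r.
Qed.

Lemma consrv_shiftS n (h t : R) (y : 'rV[R]_n) j :
  h *: delta_mx 0 (lift ord0 j) + consrv t y = consrv t (h *: delta_mx 0 j + y).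
Proof.
apply/rowP => i; rewrite [LHS]mxE [X in X + _]mxE [X in _ * X]mxE eqxx /=.
have [l ->|->] := unliftP ord0 i; first by rewrite !consrvS !mxE (inj_eq lift_inj).
by rewrite !consrv0 (negbTE (neq_lift _ _)) mulr0 add0r.
Qed.

Lemma pderiv_near n (U : set 'rV[R]_n) (i : 'I_n) (f g : 'rV[R]_n -> R) x :
  nbhs x U -> (forall y, U y -> f y = g y) ->
  (derivable f x (delta_mx 0 i) <-> derivable g x (delta_mx 0 i)) /\
  pderiv i f x = pderiv i g x.
Proof.
move=> Ux fg; split; last by apply: near_eq_derive; apply: filterS Ux.
by split; apply: near_eq_derivable; apply: filterS Ux => y /fg.
Qed.

Lemma pderiv_cst n (i : 'I_n) (c : R) : pderiv i (fun=> c) = fun=> 0.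
Proof. by apply/funext => x; exact: derive_cst. Qed.

(** Direction 0 is settled by the fundamental theorem of calculus on each line, every other
    direction by the induction hypothesis on the slices with fixed first coordinate. *)
Lemma integral_pderiv0 n (i : 'I_n) (F : 'rV[R]_n -> R) (r : R) :
  (forall x, continuous_at x F) -> (forall x, derivable F x (delta_mx 0 i)) ->
  (forall x, continuous_at x (pderiv i F)) -> (forall x, ~ cube 0 r x -> F x = 0) ->
  (\int[@lebesgue_rV R n]_x (pderiv i F x)%:E = 0)%E.
Proof.
elim: n => [|n IH] in i F *; first by case: i.
move=> cF dF cdF F0.
have dF0 x : ~ cube 0 r x -> pderiv i F x = 0.
  move=> rx; rewrite -[RHS]/((fun=> 0) x) -(pderiv_cst i 0).
  apply: (pderiv_near i _ F0).2; apply: open_nbhs_nbhs; split=> //.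
  by apply: closed_openC; exact: closed_cube.
have [E1 E2] := integral_consrv cdF dF0.
have [j ij|i0] := unliftP ord0 i.
  rewrite E1; apply: integral0_eq => t _.
  have along y := derive_along (f := F) (a := consrv t y) (v := delta_mx 0 i)
    (g := fun y => F (consrv t y)) (b := y) (w := delta_mx 0 j).
  have pE : (fun y => pderiv i F (consrv t y)) = pderiv j (fun y => F (consrv t y)).
    by apply/funext => y; apply: (along _ _).2 => h; rewrite ij consrv_shiftS.
  rewrite -[RHS](IH j (fun y => F (consrv t y))).
  - by apply: eq_integral => y _; rewrite -pE.
  - move=> y; apply: (@continuous_comp _ _ _ (consrv t) F); last exact: cF.
    exact: continuous_consrvr.
  - by move=> y; apply/(along y _).1 => // h; rewrite ij consrv_shiftS.
  - move=> y; rewrite -pE.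
    apply: (@continuous_comp _ _ _ (consrv t) (pderiv i F)); last exact: cdF.
    exact: continuous_consrvr.
  - move=> y ry; apply: F0 => rty; apply: ry => l.
    by have := rty (lift ord0 l); rewrite consrvS !mxE.
rewrite E2; apply: integral0_eq => y _.
have along t := derive_along (f := F) (a := consrv t y) (v := delta_mx 0 i)
    (g := fun t : R^o => F (consrv t y)) (b := t) (w := 1).
have pE : (fun t => pderiv i F (consrv t y)) = derive1 (fun t => F (consrv t y)).
  apply/funext => t; rewrite derive1E; apply: (along _ _).2 => h.
  by rewrite i0 consrv_shift0 [h *: 1]mulr1.
rewrite -[RHS](@integral_derive0 _ (fun t => F (consrv t y)) r).
- by apply: eq_integral => t _; rewrite -pE.
- by move=> t; apply/(along t _).1 => // h; rewrite i0 consrv_shift0 [h *: 1]mulr1.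
- move=> t; rewrite -pE.
  apply: (@continuous_comp _ _ _ (fun t => consrv t y) (pderiv i F)); last exact: cdF.
  exact: continuous_consrvl.
- move=> t rt; apply: F0 => /(_ ord0); rewrite consrv0 mxE sub0r normrN.
  by rewrite leNgt rt.
Qed.

Lemma integral_gt0 (u : R -> R) t0 : continuous u -> (forall t, 0 <= u t) -> 0 < u t0 ->
  (0 < \int[@lebesgue_measure R]_t (u t)%:E)%E.
Proof.
move=> cu u0 ut0.
have mu D : measurable_fun D (EFin \o u).
  by apply/measurable_EFinP; apply: measurable_funTS; exact: continuous_measurable_fun.
have /nbhs_ballP[e /= e0 eu] : \forall t \near t0, u t0 / 2 <= u t.
  have h2 : 0 < u t0 / 2 by rewrite divr_gt0.
  have := @cvgr_dist_lt _ _ _ _ _ _ _ (cu t0) _ h2.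
  move=> /(_ _) /=; apply: (@filterS _ (nbhs t0)) => t.
  by rewrite ltr_distlC => /andP[h _]; lra.
pose A := `]t0 - e, t0 + e[%classic; have mA : measurable A by exact: measurable_itv.
apply: (@lt_le_trans _ _ (\int[@lebesgue_measure R]_(t in A) (u t0 / 2)%R%:E)%E).
  rewrite integral_cst//= /A lebesgue_measure_itv /= lte_fin.
  rewrite ifT; last by lra.
  by rewrite -EFinB lte_fin mulr_gt0 ?divr_gt0//; lra.
apply: (@le_trans _ _ (\int[@lebesgue_measure R]_(t in A) (u t)%:E)%E).
  apply: ge0_le_integral => //.
  - by move=> t _; rewrite lee_fin divr_ge0// ltW.
  - exact: mu.
  - by move=> t; rewrite /A -ball_itv => At; rewrite lee_fin; exact: eu.
apply: ge0_subset_integral => //; first exact: mu.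
by move=> t _; rewrite lee_fin.
Qed.

(** This makes the value of the j-th functional on the j-th class nonzero. *)
Lemma integral_prod_gt0 n (u : 'I_n -> R -> R) :
  (forall i, continuous (u i)) -> (forall i t, 0 <= u i t) ->
  (forall i, exists t, 0 < u i t) ->
  (0 < \int[@lebesgue_rV R n]_x (\prod_i u i (x 0 i))%:E)%E.
Proof.
elim: n => [|n IH] in u *; move=> cu u0 ut.
  under eq_integral do rewrite big_ord0.
  by rewrite integral_cst//= diracE in_setT mul1e lte01.
have cprod m (v : 'I_m -> R -> R) x : (forall i, continuous (v i)) ->
    continuous_at x (fun x : 'rV[R]_m => \prod_i v i (x 0 i)).
  move=> cv; apply: cont_prod => i _.
  apply: (@continuous_comp _ _ _ (fun x : 'rV[R]_m => x 0 i) (v i)).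
    exact: coord_continuous.
  exact: cv.
rewrite ge0_integral_consrv; last 2 first.
- by move=> x; exact: cprod.
- by move=> x; exact: prodr_ge0.
under eq_integral => t _.
  under eq_integral => y _.
    rewrite big_ord_recl consrv0 EFinM.
    under eq_bigr do rewrite consrvS.
    over.
  rewrite ge0_integralZl//; last 3 first.
  - apply/measurable_EFinP; apply: measurable_fun_continuous => x.
    by apply: (cprod _ (fun i => u (lift ord0 i))).
  - by move=> x _; rewrite lee_fin prodr_ge0.
  - by rewrite lee_fin.
  over.
rewrite ge0_integralZr//; last 3 first.
- by apply/measurable_EFinP; exact: continuous_measurable_fun.
- by move=> t _; rewrite lee_fin.
- by apply: integral_ge0 => x _; rewrite lee_fin prodr_ge0.
apply: mule_gt0; last first.
  by apply: (IH (fun i => u (lift ord0 i))) => i; [exact: cu|exact: u0|exact: ut].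
by have [t] := ut ord0; exact: integral_gt0.
Qed.

End partial_derivative.

(** * The flat functions p(1/t) exp(-1/t) *)

Section flat_functions.
Variable R : realType.
Implicit Types (p : {poly R}) (t : R).

(** For p = 1 this is the classical exp(-1/t); the polynomial factor closes the family under
    differentiation. *)
Definition flat p t : R := if 0 < t then p.[t^-1] * expR (- t^-1) else 0.

(** With s = 1/t, the t-derivative of p(s) exp(-s) is s^2 (p - p')(s) exp(-s). *)
Definition flat_deriv p : {poly R} := 'X^2 * (p - p^`()).

(** Induction along Horner's scheme: the quotient polynomial is bounded at rate a / 2, and the other
    half of the exponential absorbs the extra factor s. *)
Lemma poly_expR_bound p (a : R) : 0 < a ->
  exists2 C : R, 0 <= C & forall s, 0 <= s -> `|p.[s]| <= C * expR (a * s).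
Proof.
elim/poly_ind: p a => [|p c IH] a a0.
  by exists 0 => // s _; rewrite horner0 normr0 mul0r.
have a2 : 0 < a / 2 by rewrite divr_gt0.
have [C C0 pC] := IH _ a2; exists (C * (2 / a) + `|c|).
  by rewrite addr_ge0// mulr_ge0// divr_ge0// ltW.
move=> s s0; rewrite hornerMXaddC; apply: le_trans (ler_normD _ _) _.
rewrite mulrDl; apply: lerD; last first.
  by rewrite ler_peMr// -expR0 ler_expR mulr_ge0// ltW.
rewrite normrM (ger0_norm s0).
have sE : s <= 2 / a * expR (a / 2 * s).
  rewrite -ler_pdivrMl ?divr_gt0// invf_div.
  by apply: le_trans (expR_ge1Dx _); rewrite lerDr.
have -> : a * s = a / 2 * s + a / 2 * s by rewrite -mulrDl -splitr.
rewrite expRD (_ : _ * (_ * _) = (C * expR (a / 2 * s)) * (2 / a * expR (a / 2 * s))).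
  by apply: ler_pM => //; exact: pC.
by ring.
Qed.

Lemma flat_le0 p t : t <= 0 -> flat p t = 0.
Proof. by move=> t0; rewrite /flat ltNge t0. Qed.

(** The exponential bound for X^2 p, read at 1/t. Quadratic decay is what gives derivative 0 at the
    origin. *)
Lemma flat_quadratic p : exists2 C : R, 0 <= C & forall t, `|flat p t| <= C * t ^+ 2.
Proof.
have [C C0 pC] := poly_expR_bound ('X^2 * p) ltr01; exists C => // t.
have [t0|t0] := leP t 0; first by rewrite flat_le0// normr0 mulr_ge0// sqr_ge0.
have := pC t^-1; rewrite invr_ge0 (ltW t0) => /(_ isT).
rewrite hornerM hornerXn mul1r normrM normrX normfV (gtr0_norm t0) exprVn.
rewrite ler_pdivrMl ?exprn_gt0// => h.
rewrite /flat t0 normrM (gtr0_norm (expR_gt0 _)) expRN ler_pdivrMr ?expR_gt0//.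
by apply: le_trans h _; rewrite mulrCA mulrA.
Qed.

Lemma is_derive_flat p t : is_derive t 1 (flat p) (flat (flat_deriv p) t).
Proof.
have [t0|t0|->] := ltgtP t 0.
- rewrite flat_le0 ?ltW//; apply: (@near_eq_is_derive _ _ _ (fun=> 0)).
  by near=> s; rewrite flat_le0// ltW//; near: s; exact: lt_nbhsl.
- have tn0 : t != 0 by rewrite gt_eqF.
  apply: (@near_eq_is_derive R R^o R^o (fun s => p.[s^-1] * expR (- s^-1))).
    by near=> s; rewrite /flat ifT//; near: s; exact: lt_nbhsr.
  have dV : is_derive t 1 (fun s : R => s^-1) (- t ^- 2).
    by have := @is_deriveV R id t 1 1 tn0 (is_derive_id _ _); rewrite /GRing.scale /= mulr1.
  have dp := @is_derive1_comp _ (horner p) _ t _ _ (is_derive_poly p t^-1) dV.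
  have dN := @is_deriveN _ _ _ _ _ _ _ dV.
  have de := @is_derive1_comp _ expR _ t _ _ (is_derive_expR (- t^-1)) dN.
  have dpe := is_deriveM dp de; refine (is_derive_eq dpe _).
  rewrite /flat t0 /flat_deriv hornerM hornerXn hornerD hornerN exprVn.
  by rewrite /GRing.scale /=; ring.
- rewrite flat_le0//; have [C C0 fC] := flat_quadratic p.
  (* The slope at 0 is O(|z|) by the quadratic bound, and its value at z = 0 is 0 because the
     inverse of 0 is 0. *)
  apply/is_derive1_caratheodory; exists (fun z => flat p z / z); split.
  + move=> z; rewrite (flat_le0 p (lexx 0)) !subr0; have [->|z0] := eqVneq z 0.
      by rewrite (flat_le0 p (lexx 0)) !mul0r.
    by rewrite divfK.
  + apply/cvgrPdist_le => e e0.
    near=> z; rewrite invr0 mulr0 sub0r normrN normf_div.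
    have [->|z0] := eqVneq z 0; first by rewrite normr0 invr0 mulr0 ltW.
    rewrite ler_pdivrMr ?normr_gt0//; apply: le_trans (fC z) _.
    rewrite -real_normK ?num_real// expr2 mulrA ler_wpM2r//.
    have zC : `|z| < e / (C + 1).
      near: z; exists (e / (C + 1)) => /=; first by rewrite divr_gt0// ltr_wpDl.
      by move=> y /=; rewrite sub0r normrN.
    apply: (@le_trans _ _ ((C + 1) * `|z|)); first by rewrite ler_wpM2r// lerDl.
    by rewrite -ler_pdivlMl ?ltr_wpDl// mulrC ltW.
  + by rewrite invr0 mulr0.
Unshelve. all: by end_near.
Qed.

Lemma continuous_flat p : continuous (flat p).
Proof.
move=> t; apply: differentiable_continuous; apply/derivable1_diffP.
by have [] := is_derive_flat p t.
Qed.

Lemma flat1_ge0 t : 0 <= flat 1 t.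
Proof. by rewrite /flat; case: ifP => // _; rewrite hornerC mul1r expR_ge0. Qed.

Lemma flat1_gt0 t : 0 < t -> 0 < flat 1 t.
Proof. by rewrite /flat => ->; rewrite hornerC mul1r expR_gt0. Qed.

Lemma flat1_lt s t : 0 < t -> s < t -> flat 1 s < flat 1 t.
Proof.
move=> t0 st; have [s0|s0] := leP s 0; first by rewrite flat_le0// flat1_gt0.
by rewrite /flat s0 t0 !hornerC !mul1r ltr_expR ltrN2 ltf_pV2.
Qed.

Lemma flat1_deriv_ge0 t : 0 <= flat (flat_deriv 1) t.
Proof.
rewrite /flat; case: ifP => // t0; rewrite /flat_deriv derivC subr0 mulr1 hornerXn.
by rewrite mulr_ge0 ?expR_ge0// exprn_ge0// invr_ge0 ltW.
Qed.

Lemma flat1_deriv_gt0 t : 0 < t -> 0 < flat (flat_deriv 1) t.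
Proof.
move=> t0; rewrite /flat t0 /flat_deriv derivC subr0 mulr1 hornerXn.
by rewrite mulr_gt0 ?expR_gt0// exprn_gt0// invr_gt0.
Qed.

End flat_functions.

(** * Smooth functions on R^n *)

Section smooth_functions.
Variables (R : realType) (n : nat).
Implicit Types (f g : 'rV[R]_n -> R) (U V : set 'rV[R]_n) (x y : 'rV[R]_n).

(** Global C^d, recursive in d instead of in a list of directions as in [smooth_on], so that the
    Leibniz rule follows by induction on d. *)
Fixpoint Cn (d : nat) f : Prop :=
  (forall x, continuous_at x f) /\
  match d with
  | 0%N => True
  | d'.+1 => forall i, (forall x, derivable f x (delta_mx 0 i)) /\ Cn d' (pderiv i f)
  end.

Lemma CnS d f : Cn d.+1 f -> Cn d f.
Proof.
elim: d f => [|d IH] f [cf df]; split=> // i.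
by have [dfi Cfi] := df i; split=> //; exact: IH.
Qed.

Lemma Cn_smooth f : (forall d, Cn d f) -> smooth_on setT f.
Proof.
move=> Cf s x _; suff : Cn 1 (foldr (@pderiv R n) f s).
  by move=> [cf df]; split; [exact: cf|move=> i; exact: (df i).1].
elim/last_ind: s f Cf => [|s i IH] f Cf; first exact: (Cf 1%N).
by rewrite foldr_rcons; apply: IH => d; have [_ /(_ i)[]] := Cf d.+1.
Qed.

Lemma Cn_cst d c : Cn d (fun=> c).
Proof.
elim: d c => [|d IH] c; split=> //; try by move=> x; exact: cst_continuous.
move=> i.
by split=> [x|]; [exact: derivable_cst|rewrite pderiv_cst].
Qed.

Lemma Cn_add d f g : Cn d f -> Cn d g -> Cn d (fun x => f x + g x).
Proof.
elim: d f g => [|d IH] f g [cf df] [cg dg]; split=> //; try by move=> x; exact: cont_add.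
move=> i.
have [dfi Cfi] := df i; have [dgi Cgi] := dg i.
split=> [x|]; first exact: (derivableD (dfi x) (dgi x)).
have -> : pderiv i (fun x => f x + g x) = fun x => pderiv i f x + pderiv i g x.
  by apply/funext => x; exact: (deriveD (dfi x) (dgi x)).
exact: IH.
Qed.

Lemma Cn_mul d f g : Cn d f -> Cn d g -> Cn d (fun x => f x * g x).
Proof.
elim: d f g => [|d IH] f g Cf Cg; have [cf df] := Cf; have [cg dg] := Cg;
  split=> //; try by move=> x; exact: cont_mul.
move=> i.
have [dfi Cfi] := df i; have [dgi Cgi] := dg i.
split=> [x|]; first exact: (derivableM (dfi x) (dgi x)).
have -> : pderiv i (fun x => f x * g x) =
    fun x => f x * pderiv i g x + g x * pderiv i f x.
  by apply/funext => x; exact: (deriveM (dfi x) (dgi x)).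
by apply: Cn_add; apply: IH => //; exact: CnS.
Qed.

Lemma Cn_prod d (I : Type) (r : seq I) (P : pred I) (F : I -> 'rV[R]_n -> R) :
  (forall i, Cn d (F i)) -> Cn d (fun x => \prod_(i <- r | P i) F i x).
Proof.
move=> CF; elim: r => [|i r IH].
  by under eq_fun do rewrite big_nil; exact: Cn_cst.
by under eq_fun do rewrite big_cons; case: (P i) => //; exact: Cn_mul.
Qed.

Lemma pderiv_coord (i j : 'I_n) (u : R -> R) (b : R) x (a : R) :
  derivable u (a + b * x 0 i) 1 ->
  derivable (fun x => u (a + b * x 0 i)) x (delta_mx 0 j) /\
  pderiv j (fun x => u (a + b * x 0 i)) x = ((j == i)%:R * b) * derive1 u (a + b * x 0 i).
Proof.
move=> du; have diffu : differentiable u (a + b * x 0 i) by exact/derivable1_diffP.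
have [|dE E] := derive_along (f := fun x => u (a + b * x 0 i)) (a := x)
    (v := delta_mx 0 j) (g := u) (b := (a + b * x 0 i : R^o)) (w := ((j == i)%:R * b : R^o)).
  move=> h; congr u; rewrite !mxE eqxx /= eq_sym.
  by rewrite /GRing.scale /= mulrDr mulrA addrCA; congr (_ + _); ring.
split; first by apply/dE; exact: diff_derivable.
rewrite /pderiv E deriveE// derive1E' //.
by rewrite -[X in 'd u _ X](mulr1 ((j == i)%:R * b)); exact: linearZ.
Qed.

Lemma Cn_flat d (p : {poly R}) (a b : R) (i : 'I_n) :
  Cn d (fun x => flat p (a + b * x 0 i)).
Proof.
have cc q x : continuous_at x (fun x : 'rV[R]_n => flat q (a + b * x 0 i)).
  apply: (@continuous_comp _ _ _ (fun x : 'rV[R]_n => a + b * x 0 i) (flat q)).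
    apply: cont_add; first exact: cst_continuous.
    by apply: cont_mul; [exact: cst_continuous|exact: coord_continuous].
  exact: continuous_flat.
elim: d p => [|d IH] p; split=> // j.
have pc x := @pderiv_coord i j (flat p) b x a (@ex_derive _ _ _ _ _ _ _ (is_derive_flat p _)).
split=> [x|]; first exact: (pc x).1.
have -> : pderiv j (fun x => flat p (a + b * x 0 i)) =
    fun x => ((j == i)%:R * b) * flat (flat_deriv p) (a + b * x 0 i).
  apply/funext => x; rewrite (pc x).2 derive1E; congr (_ * _).
  exact: (@derive_val _ _ _ _ _ _ _ (is_derive_flat p _)).
by apply: Cn_mul; [exact: Cn_cst|exact: IH].
Qed.

Lemma foldr_pderiv_near U f g s : open U -> (forall x, U x -> f x = g x) ->
  forall x, U x -> foldr (@pderiv R n) f s x = foldr (@pderiv R n) g s x.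
Proof.
move=> oU fg; elim: s => //= i s IH x Ux.
by apply: (pderiv_near i _ IH).2; exact: open_nbhs_nbhs.
Qed.

(** Smoothness depends on germs only. This is how the global notion [Cn] serves functions that are
    smooth on U alone. *)
Lemma smooth_on_local U f :
  (forall x, U x -> exists g, smooth_on setT g /\ \forall y \near x, f y = g y) ->
  smooth_on U f.
Proof.
move=> loc s x Ux; have [g [sg nfg]] := loc x Ux.
pose V := [set y | f y = g y]^°; have oV : open V by exact: open_interior.
have Vx : V x by exact: nfg.
have fg y : V y -> f y = g y by exact: (@interior_subset _ [set y | f y = g y]).
have E := foldr_pderiv_near s oV fg.
have [cg dg] := sg s x I; have nV : nbhs x V by exact: open_nbhs_nbhs.
split; last by move=> i; apply/(pderiv_near i nV E).1.
have e : \forall y \near x, foldr (@pderiv R n) g s y = foldr (@pderiv R n) f s y.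
  by apply: filterS nV => y Vy; exact/esym/E.
rewrite /prop_for /continuous_at E//.
exact: (cvg_trans (near_eq_cvg e) cg).
Qed.

Lemma pderiv_prod_coord (i : 'I_n) (v : 'I_n -> R -> R) (z : 'I_n -> R) x :
  derivable (v i) (x 0 i - z i) 1 ->
  derivable (fun x => \prod_l v l (x 0 l - z l)) x (delta_mx 0 i) /\
  pderiv i (fun x => \prod_l v l (x 0 l - z l)) x =
    \prod_l (if l == i then derive1 (v i) else v l) (x 0 l - z l).
Proof.
move=> dv; pose c := \prod_(l | l != i) v l (x 0 l - z l).
have [|d E] := derive_along (f := fun x => \prod_l v l (x 0 l - z l)) (a := x)
    (v := delta_mx 0 i) (g := fun t : R^o => c *: (v i t : R^o))
    (b := (x 0 i - z i : R^o)) (w := (1 : R^o)).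
  move=> h; rewrite (bigD1 i) //= mulrC /GRing.scale /= mulr1.
  rewrite !mxE !eqxx mulr1 addrA; congr (_ * _).
  apply: eq_bigr => l li; rewrite !mxE eqxx (negbTE li) mulr0 add0r//.
split; first by apply/d; exact: derivableZ.
rewrite /pderiv E deriveZ// (bigD1 i) //= eqxx mulrC derive1E; congr (_ * _).
by apply: eq_bigr => l /negbTE ->.
Qed.

End smooth_functions.

(** * Positive definite matrices and their tensor powers *)

Section positive_definite.
Variable R : rcfType.

(** A Cholesky factorisation by induction: the Schur complement of the corner entry is again
    positive definite. *)
Lemma posdef_factor n (A : 'M[R]_n) : A^T = A ->
  (forall v : 'rV[R]_n, v != 0 -> 0 < (v *m A *m v^T) 0 0) ->
  exists2 P, P \in unitmx & A = P *m P^T.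
Proof.
elim: n A => [|n IH] A At A0.
  by exists 1%:M; [exact: unitmx1|rewrite [LHS]flatmx0 [RHS]flatmx0].
move: A At A0; rewrite -[n.+1]/(1 + n)%N => A At A0.
pose a := ulsubmx A 0 0; pose b := ursubmx A; pose C := drsubmx A.
have aE : ulsubmx A = a%:M by rewrite [LHS]mx11_scalar.
have bE : dlsubmx A = b^T by rewrite /b -{1}At -trmx_ursub.
have AE : A = block_mx a%:M b b^T C by rewrite -aE -bE submxK.
have Ct : C^T = C by rewrite /C trmx_drsub At.
have quad (x : R) (w : 'rV[R]_n) :
    (row_mx x%:M w *m A *m (row_mx x%:M w)^T) 0 0 =
    a * x ^+ 2 + 2 * x * (w *m b^T) 0 0 + (w *m C *m w^T) 0 0.
  rewrite AE mul_row_block tr_row_mx mul_row_col tr_scalar_mx mulmxDl mulmxDl.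
  rewrite !mul_scalar_mx !mul_mx_scalar -!scalemxAl.
  have -> : b *m w^T = w *m b^T.
    by rewrite -[RHS]trmxK trmx_mul trmxK [b *m _]mx11_scalar tr_scalar_mx.
  move: (w *m b^T) (w *m C *m w^T) => W Z; rewrite !mxE eqxx mulr1n; ring.
have a0 : 0 < a.
  have := A0 (row_mx 1%:M 0); rewrite quad mul0mx mxE mul0mx mul0mx mxE.
  rewrite expr1n !mulr0 !addr0 !mulr1; apply.
  by apply/eqP => /(congr1 (fun M : 'rV_(1 + n) => M 0 (lshift n 0))); rewrite row_mxEl !mxE => /eqP; rewrite oner_eq0.
pose s := Num.sqrt a; have s0 : 0 < s by rewrite sqrtr_gt0.
have s2 : s * s = a by rewrite -expr2 sqr_sqrtr// ltW.
pose l := s^-1 *: b.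
have [P' P'u CE] : exists2 P, P \in unitmx & C - l^T *m l = P *m P^T.
  apply: IH; first by rewrite linearB /= Ct trmx_mul trmxK.
  (* This x minimises the quadratic form at (x, w) over x; the minimum is the value of the Schur
     complement at w. *)
  move=> w w0; pose x := - (w *m b^T) 0 0 / a.
  have := A0 (row_mx x%:M w); rewrite quad => /(_ _).
  have -> : (w *m (C - l^T *m l) *m w^T) 0 0 =
      a * x ^+ 2 + 2 * x * (w *m b^T) 0 0 + (w *m C *m w^T) 0 0.
    rewrite mulmxBr mulmxBl mulmxA -(mulmxA _ l) mxE [X in _ + X = _]mxE.
    have -> : l *m w^T = (w *m l^T)^T by rewrite trmx_mul trmxK.
    rewrite [w *m l^T]mx11_scalar tr_scalar_mx mul_scalar_mx.
    have -> : (w *m l^T) 0 0 = s^-1 * (w *m b^T) 0 0.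
      by rewrite /l linearZ /= -scalemxAr mxE.
    rewrite [X in _ - X]mxE [X in _ * X]mxE eqxx mulr1n /x -s2.
    by field; rewrite gt_eqF.
  apply; apply/eqP => /(congr1 rsubmx); rewrite row_mxKr linear0 => w00.
  by rewrite w00 eqxx in w0.
exists (block_mx s%:M 0 l^T P').
  by rewrite unitmxE det_lblock det_scalar1 unitrM -unitmxE P'u andbT unitfE gt_eqF.
rewrite AE tr_block_mx mulmx_block !trmx0 !mul0mx !mulmx0 !addr0 tr_scalar_mx trmxK.
rewrite mul_mx_scalar mul_scalar_mx -CE addrC subrK mul_mx_scalar.
have sl : s *: l = b by rewrite /l scalerA mulfV ?gt_eqF// scale1r.
have -> : s *: l^T = b^T by rewrite -sl [RHS]linearZ.
by rewrite scale_scalar_mx s2 sl.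
Qed.

End positive_definite.

Section tensor_power.
Variables (R : realFieldType) (n k : nat).
Implicit Types (M N : 'M[R]_n) (I J K : {ffun 'I_k -> 'I_n}) (a e : {ffun 'I_k -> 'I_n} -> R).

(** The matrix of the k-th tensor power of M; for the inverse metric it is the kernel of
    [form_inner]. *)
Definition tensor M I J : R := \prod_(p < k) M (I p) (J p).

Lemma tensor_mul M N I J : \sum_K tensor M I K * tensor N K J = tensor (M *m N) I J.
Proof.
rewrite /tensor; under eq_bigr do rewrite -big_split /=.
by rewrite -(bigA_distr_bigA (fun p j => M (I p) j * N j (J p))); apply: eq_bigr => p _; rewrite mxE.
Qed.

Lemma tensor1 I J : tensor 1%:M I J = (I == J)%:R.
Proof.
rewrite /tensor; have [->|] := eqVneq I J.
  by rewrite big1// => p _; rewrite mxE eqxx.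
move=> IJ; have [p Ip] : exists p, I p != J p.
  apply/existsP; apply: contraR IJ; rewrite negb_exists => /forallP h.
  by apply/eqP/ffunP => p; apply/eqP; rewrite -[_ == _]negbK.
by rewrite (bigD1 p) //= mxE (negbTE Ip) mul0r.
Qed.

Lemma tensor_tr M I J : tensor M^T I J = tensor M J I.
Proof. by apply: eq_bigr => p _; rewrite mxE. Qed.

Lemma sum_tensor_mul M N a e :
  \sum_K (\sum_I tensor M I K * a I) * (\sum_J tensor N K J * e J) =
  \sum_I \sum_J tensor (M *m N) I J * a I * e J.
Proof.
under eq_bigr => K _.
  rewrite big_distrl /=; under eq_bigr do rewrite big_distrr /=; over.
rewrite exchange_big /=; apply: eq_bigr => I _.
rewrite exchange_big /=; apply: eq_bigr => J _.
rewrite -tensor_mul !big_distrl /=; apply: eq_bigr => K _; ring.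
Qed.

(* With M = Q^T Q the tensor power of M becomes a sum of squares, and the claim is AM-GM termwise. *)
Lemma tensor_amgm M s a e : s > 0 ->
  (exists2 P, P \in unitmx & M = P *m P^T) ->
  2 * \sum_I a I * e I <=
    s * (\sum_I \sum_J tensor (invmx M) I J * a I * a J) +
    s^-1 * \sum_I \sum_J tensor M I J * e I * e J.
Proof.
move=> s0 [P Pu ->]; set Q := invmx P.
have Qu : Q \in unitmx by rewrite unitmx_inv.
have QE : invmx (P *m P^T) = Q^T *m Q.
  have PPu : P *m P^T \in unitmx by rewrite unitmx_mul unitmx_tr Pu.
  rewrite -[LHS]mulmx1 -[X in _ *m X](_ : P *m P^T *m (Q^T *m Q) = _).
    by rewrite mulKmx.
  by rewrite mulmxA -(mulmxA P) -trmx_mul mulVmx// trmx1 mulmx1 mulmxV.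
have -> : \sum_I a I * e I = \sum_I \sum_J tensor (Q^T *m P^T) I J * a I * e J.
  rewrite -trmx_mul mulmxV// trmx1; apply: eq_bigr => I _.
  rewrite (bigD1 I) //= tensor1 eqxx mul1r big1 ?addr0// => J JI.
  by rewrite tensor1 eq_sym (negbTE JI) !mul0r.
rewrite QE -!sum_tensor_mul !mulr_sumr -big_split /=; apply: ler_sum => K _.
have -> : \sum_J tensor Q K J * a J = \sum_I tensor Q^T I K * a I.
  by apply: eq_bigr => I _; rewrite tensor_tr.
have -> : \sum_I tensor P I K * e I = \sum_J tensor P^T K J * e J.
  by apply: eq_bigr => I _; rewrite tensor_tr.
set x := \sum_I _; set y := \sum_J _.
have : 0 <= s^-1 * (s * x - y) ^+ 2 by rewrite mulr_ge0 ?sqr_ge0// invr_ge0 ltW.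
have -> : s^-1 * (s * x - y) ^+ 2 = s * (x * x) + s^-1 * (y * y) - 2 * (x * y).
  by field; rewrite gt_eqF.
by rewrite subr_ge0.
Qed.

End tensor_power.

Lemma det_posdef_gt0 (R : rcfType) n (A : 'M[R]_n) : A^T = A ->
  (forall v : 'rV[R]_n, v != 0 -> 0 < (v *m A *m v^T) 0 0) -> 0 < \det A.
Proof.
move=> At A0; have [P Pu ->] := posdef_factor At A0.
rewrite det_mulmx det_tr -expr2 lt_neqAle sqr_ge0 andbT eq_sym expf_neq0//.
by rewrite -unitfE -unitmxE.
Qed.

(** * Multi-indices, faces and signs *)

Section multi_indices.
Variables (R : realFieldType) (n : nat).

(** Here a and b are distinct positions, c is the rank of b once a is removed, d that of a once b is
    removed. Removing both leaves the same list in either order. *)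
Lemma bump_bump (a b c d r : nat) : a = bump b d -> b = bump a c ->
  bump a (bump c r) = bump b (bump d r).
Proof. by rewrite /bump; do 6 ?case: leqP => ? /=; lia. Qed.

(** Removing the smaller position shifts the larger one by 1, and not conversely; hence the opposite
    signs in d d. *)
Lemma odd_bump (a b c d : nat) : a = bump b d -> b = bump a c ->
  odd (a + c) = ~~ odd (b + d).
Proof. by rewrite /bump; do 2 ?case: leqP => ? /=; lia. Qed.

(** The pairs (p, [lift p q]) are the ordered pairs of distinct indices, so exchanging the two turns
    the sum into its negative. *)
Lemma sum_lift_antisym k (X : 'I_k.+2 -> 'I_k.+2 -> R) :
  (forall p q, p != q -> X p q = - X q p) -> \sum_p \sum_q X p (lift p q) = 0.
Proof.
move=> Xa; pose Y p q := if p == q then 0 else X p q.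
have -> : \sum_p \sum_q X p (lift p q) = \sum_p \sum_q Y p q.
  apply: eq_bigr => p _; rewrite [RHS](bigD1_ord p) //= /Y eqxx add0r.
  by apply: eq_bigr => q _; rewrite (negbTE (neq_lift _ _)).
set S := \sum_p _; suff SN : S = - S by move: SN; lra.
rewrite {1}/S exchange_big /= /S -sumrN; apply: eq_bigr => p _.
rewrite -sumrN; apply: eq_bigr => q _; rewrite /Y eq_sym.
by case: eqVneq => [_|pq]; [rewrite oppr0|apply: Xa; rewrite eq_sym].
Qed.

(* The cancellation behind d (d c) = 0. *)
Lemma sum_face_face k (I : {ffun 'I_k.+2 -> 'I_n}) (c : {ffun 'I_k -> 'I_n} -> R)
    (S : 'I_k.+2 -> 'I_k.+2 -> R) : (forall p q, S p q = S q p) ->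
  \sum_(p < k.+2) \sum_(q < k.+1) (-1) ^+ p * (-1) ^+ q * c (face (face I p) q) * S p (lift p q) = 0.
Proof.
move=> Ss.
pose X p p' := if unlift p p' is Some q
  then (-1) ^+ p * (-1) ^+ q * c (face (face I p) q) * S p p' else 0.
rewrite -[RHS](@sum_lift_antisym _ X) => [|p p' pp'].
  by apply: eq_bigr => p _; apply: eq_bigr => q _; rewrite /X liftK.
have p'p : p' != p by rewrite eq_sym.
rewrite /X; have [q p'E ->] := unlift_some pp'; have [q' pE ->] := unlift_some p'p.
rewrite (Ss p' p).
have [vp vp'] : p = bump p' q' :> nat /\ p' = bump p q :> nat by rewrite {1}pE p'E.
have -> : face (face I p) q = face (face I p') q'.
  apply/ffunP => r; rewrite !ffunE; congr (I _); apply/val_inj => /=.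
  exact: bump_bump.
suff -> : (-1) ^+ p * (-1) ^+ q = - ((-1) ^+ p' * (-1) ^+ q') :> R by ring.
rewrite -!exprD -[RHS]mulN1r -exprS -signr_odd -[RHS]signr_odd; congr (_ ^+ _); congr nat_of_bool.
by rewrite (odd_bump vp vp').
Qed.

Variables (k : nat) (J : {ffun 'I_k -> 'I_n}).

(* The component of multi-index I of dx_{J 0} /\ ... /\ dx_{J (k-1)}. *)
Definition wedge (I : {ffun 'I_k -> 'I_n}) : R :=
  \det (\matrix_(p < k, q < k) (I p == J q)%:R).

Lemma wedge_perm (I : {ffun 'I_k -> 'I_n}) (s : 'S_k) : wedge [ffun p => I (s p)] = (-1) ^+ s * wedge I.
Proof.
rewrite /wedge -det_perm -det_mulmx -row_permE; congr (\det _).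
by apply/matrixP => p q; rewrite !mxE ffunE.
Qed.

Lemma wedge_id : injective J -> wedge J = 1.
Proof.
move=> Jinj; rewrite /wedge -[RHS](det1 _ k); congr (\det _).
by apply/matrixP => p q; rewrite !mxE (inj_eq Jinj).
Qed.

Lemma wedge_eq0 (I : {ffun 'I_k -> 'I_n}) p : (forall q, I p != J q) -> wedge I = 0.
Proof.
move=> IJ; rewrite /wedge (expand_det_row _ p) big1// => q _.
by rewrite mxE (negbTE (IJ q)) mul0r.
Qed.

(* df /\ dx_J = 0 if df only involves the dx_i with i in the image of J. *)
Lemma sum_wedge_face (I : {ffun 'I_k.+1 -> 'I_n}) (v : 'I_n -> R) : injective J ->
  (forall i, (forall q, i != J q) -> v i = 0) ->
  \sum_(p < k.+1) (-1) ^+ p * (v (I p) * wedge (face I p)) = 0.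
Proof.
move=> Jinj v0.
(* The matrix A B is square of size k + 1 but factors through dimension k, so its determinant is 0.
   Its columns are v(I p) and the indicators of I p = J q, and expansion along the first column
   gives the sum. *)
pose A : 'M[R]_(k.+1, k) := \matrix_(p, q) (I p == J q)%:R.
pose B : 'M[R]_(k, k.+1) := \matrix_(q, c) if unlift ord0 c is Some q' then (q == q')%:R else v (J q).
have N0 : \det (A *m B) = 0.
  apply/eqP; apply: contraT => N0.
  have : A *m B \in unitmx by rewrite unitmxE unitfE.
  by move=> /mxrank_unit rk; have := mulmx_max_rank A B; rewrite rk ltnn.
rewrite -[RHS]N0 (expand_det_col _ ord0); apply: eq_bigr => p _.
have -> : (A *m B) p ord0 = v (I p).
  rewrite mxE; have [[q Iq]|Ip] := pselect (exists q, I p = J q).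
    rewrite (bigD1 q) //= !mxE unlift_none Iq eqxx mul1r big1 ?addr0// => q' q'q.
    by rewrite !mxE Iq (inj_eq Jinj) eq_sym (negbTE q'q) mul0r.
  have Ip' q : I p != J q by apply/eqP => h; apply: Ip; exists q.
  by rewrite v0// big1// => q _; rewrite !mxE (negbTE (Ip' q)) mul0r.
rewrite /cofactor addn0 mulrCA; congr (_ * (_ * _)).
rewrite /wedge; congr (\det _); apply/matrixP => r q.
rewrite !mxE ffunE (bigD1 q) //= !mxE liftK eqxx mulr1 big1 ?addr0// => q' q'q.
by rewrite !mxE liftK (negbTE q'q) mulr0.
Qed.

End multi_indices.

(** * Open subsets of R^n as manifolds *)

Section open_submanifold.
Variables (R : realType) (n : nat) (U : set 'rV[R]_n) (e : 'rV[R]_n).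
Hypotheses (oU : open U) (Ue : U e).

Let T : topologicalType := set_type U.
(** The value of [param] outside U, which is why a point of U is given. The atlas is indexed by nat,
    so all charts after the first get an empty domain. *)
Let base : T := SigSub (mem_set Ue).
Let dom (i : nat) : set T := if i is 0%N then setT else set0.
Let chart (i : nat) (t : T) : 'rV[R]_n := val t.
Let param (i : nat) (x : 'rV[R]_n) : T := insubd base x.

Let valT (t : T) : U (val t).
Proof. exact: set_mem (valP t). Qed.

Let paramK i x : U x -> val (param i x) = x.
Proof. by move=> Ux; rewrite /param val_insubd mem_set. Qed.

Let val_continuous : continuous (fun t : T => val t).
Proof. exact: initial_continuous. Qed.

Let T_hausdorff : hausdorff_space T.
Proof.
move=> p q pq; apply: val_inj.
apply: (@norm_hausdorff R 'rV[R]_n) => A B pA qB.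
have [t [At Bt]] := pq _ _ (val_continuous pA) (val_continuous qB).
by exists (val t).
Qed.

Let chartT i : chart i @` dom i = (if i is 0%N then U else set0).
Proof.
case: i => [|i]; last by rewrite image_set0.
apply/seteqP; split=> [_ [t _ <-]|x Ux]; first exact: valT.
by exists (param 0%N x) => //; exact: paramK.
Qed.

Let T_dom_cover : \bigcup_i dom i = setT.
Proof. by apply/seteqP; split=> // t _; exists 0%N. Qed.

Let T_dom_open i : open (dom i).
Proof. by case: i => [|i]; [exact: openT|exact: open0]. Qed.

Let T_chart_open i : open (chart i @` dom i).
Proof. by rewrite chartT; case: i => [|i]; [exact: oU|exact: open0]. Qed.

Let T_chartK i : {in dom i, cancel (chart i) (param i)}.
Proof. by move=> t _; exact: valKd. Qed.

Let T_chart_continuous i : {in dom i, continuous (chart i)}.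
Proof. by move=> t _; exact: val_continuous. Qed.

Let T_param_continuous i : {in chart i @` dom i, continuous (param i)}.
Proof.
move=> x; rewrite chartT; case: i => [|i] /set_mem // Ux A [/= B [[W oW <-] /= Wx] BA].
have {}Wx : W x by rewrite -(paramK 0 Ux).
have : nbhs x (W `&` U) by apply: open_nbhs_nbhs; split => //; exact: openI.
by apply: filterS => y [Wy Uy]; apply: BA; rewrite /= -[set_val _]/(val (param 0%N y)) paramK.
Qed.

Let T_transition_smooth i j l :
  smooth_on (chart i @` (dom i `&` dom j)) (fun x => chart j (param i x) 0 l).
Proof.
apply: smooth_on_local => _ [t _ <-]; exists (fun x => x 0 l); split; last first.
  have : nbhs (val t) U by apply: open_nbhs_nbhs.
  by apply: filterS => y Uy; rewrite /chart paramK.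
apply: Cn_smooth => -[|d]; split=> //; try by move=> x; exact: coord_continuous.
move=> q.
have dl x := @pderiv_coord R n l q id 1 x 0
  (@ex_derive _ _ _ _ _ _ _ (is_derive_id (0 + 1 * x 0 l) (1 : R^o))).
have E : (fun x : 'rV[R]_n => id (0 + 1 * x 0 l)) = fun x => x 0 l.
  by apply/funext => x; rewrite /= add0r mul1r.
rewrite E in dl; split=> [x|]; first exact: (dl x).1.
have -> : pderiv q (fun x : 'rV[R]_n => x 0 l) = fun=> (q == l)%:R.
  apply/funext => x; rewrite (dl x).2 derive1E.
  by rewrite (@derive_val _ _ _ _ _ _ _ (is_derive_id _ _)) !mulr1.
exact: Cn_cst.
Qed.

Definition open_submanifold : manifold R n :=
  Manifold T_hausdorff T_dom_cover T_dom_open T_chart_open T_chartK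
    T_chart_continuous T_param_continuous T_transition_smooth.

Local Notation M := open_submanifold.

Lemma cod_open_submanifold i : cod M i = if i is 0%N then U else set0.
Proof. exact: chartT. Qed.

Lemma overlap_open_submanifold i j x : overlap M i j x -> [/\ i = 0%N, j = 0%N & U x].
Proof. by case: i j => [|i] [|j] [t] // [] // _ _ <-; split=> //; exact: valT. Qed.

Lemma transition_open_submanifold x : U x -> transition M 0 0 x = x.
Proof. exact: paramK. Qed.

Lemma param_open_submanifold_continuous x : U x -> continuous_at x (Defs.param M 0).
Proof. by move=> Ux; apply: T_param_continuous; rewrite chartT; exact: mem_set. Qed.

(** The transition map is known to be the identity only on U, so its differential is obtained from
    the germ at x by uniqueness. *)
Lemma tjac_open_submanifold x : U x -> tjac M 0 0 x = 1%:M.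
Proof.
move=> Ux; rewrite /tjac /jacobian.
have -> : 'd (transition M 0 0) x = idfun :> ('rV[R]_n -> 'rV[R]_n).
  apply: diff_unique; first by move=> y; exact: cvg_id.
  apply/eqaddoP => eps eps0.
  have Ux0 : nbhs (0 : 'rV[R]_n) [set v | U (v + x)].
    have /nbhs_rVP[r r0 rU] : nbhs x U by apply: open_nbhs_nbhs.
    apply/nbhs_rVP; exists r => // v vr; apply: rU => i; rewrite mxE opprD addrCA subrr addr0.
    by have := vr i; rewrite mxE sub0r.
  apply: filterS Ux0 => v /= Uvx.
  have -> : (transition M 0 0 \o +%R^~ x - (cst (chart 0 (param 0 x)) + idfun)) v = 0.
    rewrite -[LHS]/(transition M 0 0 (v + x) - (transition M 0 0 x + v)).
    by rewrite !transition_open_submanifold// [v + x]addrC subrr.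
  by rewrite normr0 mulr_ge0// ltW.
by apply/matrixP => i j; rewrite !mxE eqxx eq_sym.
Qed.

Lemma oriented_open_submanifold : oriented M.
Proof.
move=> i j x /overlap_open_submanifold [-> -> Ux].
by rewrite tjac_open_submanifold// det1.
Qed.

Lemma open_submanifold_nonempty : [set: M] !=set0.
Proof. by exists base. Qed.

Lemma connected_open_submanifold : connected U -> connected [set: M].
Proof.
move=> cU; have -> : [set: M] = Defs.param M 0 @` U.
  apply/seteqP; split=> // t _; exists (val t); first exact: valT.
  exact: valKd.
apply: connected_continuous_connected => //.
apply: continuous_in_subspaceT => x /set_mem Ux.
exact: param_open_submanifold_continuous.
Qed.

Lemma piece_open_submanifold i : chart i @` @piece R n M i = if i is 0%N then U else set0.
Proof.
rewrite /piece; case: i => [|i]; first by rewrite /seqDU big_ord0 setD0; exact: chartT.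
have -> : seqDU (Defs.dom M) i.+1 = set0 by apply/seteqP; split=> // t [].
by rewrite image_set0.
Qed.

Lemma integral_vol_open_submanifold (g : metric_field R n) (f : nat -> 'rV[R]_n -> R) :
  integral_vol M g f =
  (\int[@lebesgue_rV R n]_(x in U) (f 0%N x * Num.sqrt (\det (g 0%N x)))%:E)%E.
Proof.
rewrite /integral_vol; apply: lim_near_cst => //.
exists 1%N => // -[|m] // _; rewrite big_ltn//= piece_open_submanifold.
by rewrite big_nat_cond big1 ?adde0// => -[|i] // _; rewrite piece_open_submanifold integral_set0.
Qed.

End open_submanifold.

(** * Connectedness by segments *)

Section connected_sets.
Variables (R : realType) (n : nat).
Implicit Types (a b x : 'rV[R]_n) (U : set 'rV[R]_n).

Definition segment_rV a b : set 'rV[R]_n :=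
  (fun t => \row_i (a 0 i + t * (b 0 i - a 0 i))) @` `[0, 1].

Lemma connected_segment_rV a b : connected (segment_rV a b).
Proof.
apply: connected_continuous_connected; first exact: segment_connected.
apply: continuous_subspaceT => t; apply: continuous_rV => i.
rewrite (_ : (fun s : R => _) = fun s => a 0 i + s * (b 0 i - a 0 i)); last first.
  by apply/funext => s; rewrite mxE.
apply: cont_add; first exact: cst_continuous.
by apply: cont_mul; [exact: cvg_id|exact: cst_continuous].
Qed.

Lemma segment_rVl a b : segment_rV a b a.
Proof. by exists 0; [rewrite /= bound_itvE|apply/rowP => i; rewrite mxE mul0r addr0]. Qed.

Lemma segment_rVr a b : segment_rV a b b.
Proof. by exists 1; [rewrite /= bound_itvE|apply/rowP => i; rewrite mxE mul1r addrC subrK]. Qed.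

Lemma connected_from U e :
  (forall x, U x -> exists C, [/\ connected C, C `<=` U, C x & C e]) -> connected U.
Proof.
move=> conn; pose P (C : set 'rV[R]_n) := [/\ connected C, C `<=` U & C e].
have -> : U = \bigcup_(C in P) C.
  apply/seteqP; split=> [x /conn[C [cC CU Cx Ce]]|x [C [_ CU _] /CU]//].
  by exists C.
by apply: bigcup_connected => [|C []//]; exists e => C [].
Qed.

Lemma connected_setT_rV : connected [set: 'rV[R]_n].
Proof.
apply: (@connected_from _ 0) => x _; exists (segment_rV x 0); split=> //.
- exact: connected_segment_rV.
- exact: segment_rVl.
- exact: segment_rVr.
Qed.

End connected_sets.

(** * The complement of the holes *)

Section holes.
Variables (R : realType) (n' : nat).
Local Notation n := n'.+2.
Implicit Types (x y : 'rV[R]_n).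

Let i1 : 'I_n := lift ord0 ord0.

(* The m-th hole is the product of k + 1 intervals and R^(n-k-1), for k = m %% n; a k-sphere around it carries a k-dimensional cohomology class. *)
Definition holes_compl : set 'rV[R]_n := [set x | forall m : nat, (0 < m %% n)%N ->
  1 < `|x 0 ord0 - 8 * m%:R| \/ exists i : 'I_n, (0 < i <= m %% n)%N /\ 1 < `|x 0 i|].

Local Notation U := holes_compl.

(** The family of holes is locally finite: their coordinates 0 tend to infinity, so near x only
    those with m < N matter, and these give finitely many open conditions. *)
Lemma open_holes_compl : open U.
Proof.
rewrite openE => x Ux.
have gt1 (f : 'rV[R]_n -> R) : continuous f -> 1 < `|f x| -> \forall y \near x, 1 < `|f y|.
  move=> cf fx; have : nbhs `|f x| [set t | 1 < t] by exact: lt_nbhsr.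
  exact: (cont_norm (cf x)).
have cc (i : 'I_n) (c : R) : continuous (fun y : 'rV[R]_n => y 0 i - c).
  by move=> y; apply: cont_sub; [exact: coord_continuous|exact: cst_continuous].
pose N := (Num.truncn (`|x 0 ord0| + 2)).+1.
have far : nbhs x [set y : 'rV[R]_n | forall m, (N <= m)%N ->
    1 < `|y 0 ord0 - 8 * m%:R|].
  apply/nbhs_rVP; exists 1 => // y xy m Nm.
  have h1 : `|x 0 ord0| + 2 < m%:R by apply: lt_le_trans (truncnS_gt _) _; rewrite ler_nat.
  have h2 := xy ord0; have h3 := ler_norm (x 0 ord0).
  have h4 : 0 <= `|x 0 ord0| by [].
  rewrite distrC; apply: lt_le_trans (ler_norm _); move: h2.
  by rewrite ltr_distl => /andP[h2 _]; lra.
pose Q (m : 'I_N) (y : 'rV[R]_n) := (0 < m %% n)%N ->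
    1 < `|y 0 ord0 - 8 * m%:R| \/ exists i : 'I_n, (0 < i <= m %% n)%N /\ 1 < `|y 0 i|.
have nearQ m : nbhs x (Q m).
  have [m0|m0] := boolP (0 < m %% n)%N; last first.
    by apply: filterS (filterT : nbhs x setT) => y _; rewrite /Q (negbTE m0).
  have [h|[i [im h]]] := Ux m m0.
    by have := gt1 _ (cc ord0 _) h; apply: filterS => y hy _; left.
  have := gt1 _ (@coord_continuous _ _ _ 0 i) h.
  by apply: filterS => y hy _; right; exists i.
have close : nbhs x (fun y => forall m, Q m y) by exact: (@filter_forall _ _ Q (nbhs x) (nbhs_filter x) nearQ).
apply: filterS2 far close => y fary closey m m0.
by have [/fary|mN] := leqP N m; [left|exact: (closey (Ordinal mN))].
Qed.

Let upd x (i : 'I_n) (v : R) : 'rV[R]_n := \row_j (if j == i then v else x 0 j).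

Lemma holes_compl_coord1 x : 1 < `|x 0 i1| -> U x.
Proof. by move=> x1 m m0; right; exists i1. Qed.

(** Every hole lies in |x_1| <= 1 and to the right of x_0 = -2. A point with x_1 >= -1 rises to x_1
    = 2 without entering a hole; a lower one first slides below the holes to x_0 = -2 and rises
    there. The level x_1 = 2 is free of holes. *)
Lemma connected_holes_compl : connected U.
Proof.
have i10 : (ord0 == i1) = false by [].
pose e : 'rV[R]_n := \row_j (if j == i1 then 2 else 0).
have to_e x : x 0 i1 = 2 -> segment_rV x e `<=` U.
  move=> x1 _ [t _ <-]; apply: holes_compl_coord1.
  by rewrite !mxE eqxx x1 subrr mulr0 addr0 ger0_norm// ltr1n.
have up x : U x -> -1 <= x 0 i1 -> segment_rV x (upd x i1 2) `<=` U.
  move=> Ux x1 _ [t t01 <-] m m0.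
  have /andP[t0 t1] : 0 <= t <= 1 by move: t01; rewrite /= in_itv.
  have [h|[i [im h]]] := Ux m m0; [left|right].
    by rewrite !mxE i10 subrr mulr0 addr0.
  exists i; split=> //; rewrite !mxE; case: eqVneq => [ii|_]; last by rewrite subrr mulr0 addr0.
  move: h; rewrite ii ltr_normr => /orP[h|h]; last by lra.
  rewrite ltr_normr; apply/orP; left.
  have h2 : 0 <= (1 - t) * (x 0 i1 - 1) by rewrite mulr_ge0// subr_ge0// ltW.
  have [t2|t2] := leP t (1 / 2); nra.
apply: (@connected_from _ _ _ e) => x Ux.
have updi y v : upd y i1 v 0 i1 = v by rewrite mxE eqxx.
have [x1|x1] := leP (-1) (x 0 i1).
  exists (segment_rV x (upd x i1 2) `|` segment_rV (upd x i1 2) e); split.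
  - apply: connectedU; try exact: connected_segment_rV.
    by exists (upd x i1 2); split; [exact: segment_rVr|exact: segment_rVl].
  - by rewrite subUset; split; [exact: up|exact: to_e].
  - by left; exact: segment_rVl.
  - by right; exact: segment_rVr.
pose y := upd x ord0 (- 2).
have yseg : segment_rV x y `<=` U.
  move=> _ [t _ <-]; apply: holes_compl_coord1.
  by rewrite !mxE eq_sym i10 subrr mulr0 addr0 ltr_normr; apply/orP; right; lra.
have yseg' : segment_rV y (upd y i1 2) `<=` U.
  move=> _ [t _ <-] m m0; left; rewrite !mxE i10 eqxx subrr mulr0 addr0.
  have : 0 <= m%:R :> R by [].
  by rewrite ltr_normr => h; apply/orP; right; lra.
exists (segment_rV x y `|` segment_rV y (upd y i1 2) `|` segment_rV (upd y i1 2) e); split.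
- apply: connectedU; try exact: connected_segment_rV.
    by exists (upd y i1 2); split; [right; exact: segment_rVr|exact: segment_rVl].
  apply: connectedU; try exact: connected_segment_rV.
  by exists y; split; [exact: segment_rVr|exact: segment_rVl].
- by rewrite !subUset; split=> //; exact: to_e.
- by left; left; exact: segment_rVl.
- by right; exact: segment_rVr.
Qed.

Lemma holes_compl_nonempty : U (const_mx 2).
Proof. by apply: holes_compl_coord1; rewrite mxE ger0_norm// ltr1n. Qed.

End holes.

(** * Plateau and bump functions *)

Section plateau.
Variable R : realType.
Local Notation f := (flat (1 : {poly R})).
Local Notation f' := (flat (flat_deriv (1 : {poly R}))).

(* Constant on [-2, 2] and zero outside [-3, 3]. *)
Definition plateau (t : R) : R := f (f 1 - f (t - 2) - f (- t - 2)).

Definition plateau' (t : R) : R :=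
  f' (f 1 - f (t - 2) - f (- t - 2)) * (f' (- t - 2) - f' (t - 2)).

Lemma is_derive_plateau (t : R) : is_derive t 1 plateau (plateau' t).
Proof.
have d1 : is_derive t 1 (fun t : R => t - 2) 1.
  have := is_deriveB (is_derive_id t (1 : R^o)) (is_derive_cst (2 : R^o) t (1 : R^o)).
  by rewrite subr0.
have d2 : is_derive t 1 (fun t : R => - t - 2) (-1).
  have := is_deriveB (is_deriveNid t (1 : R^o)) (is_derive_cst (2 : R^o) t (1 : R^o)).
  by rewrite subr0.
have e1 := @is_derive1_comp _ f (fun t : R => t - 2) _ _ _ (is_derive_flat 1 (t - 2)) d1.
have e2 := @is_derive1_comp _ f (fun t : R => - t - 2) _ _ _ (is_derive_flat 1 (- t - 2)) d2.
have e3 := is_deriveB (is_deriveB (is_derive_cst (f 1 : R^o) t (1 : R^o)) e1) e2.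
have := @is_derive1_comp _ f (fun t => f 1 - f (t - 2) - f (- t - 2)) _ _ _
  (is_derive_flat 1 (f 1 - f (t - 2) - f (- t - 2))) e3.
move=> e4; refine (is_derive_eq e4 _); rewrite /plateau'; congr (_ * _).
by rewrite mulr1 mulrN1 opprK sub0r addrC.
Qed.

Lemma continuous_plateau : continuous plateau.
Proof.
move=> t; apply: differentiable_continuous; apply/derivable1_diffP.
by have [] := is_derive_plateau t.
Qed.

Lemma continuous_plateau' : continuous plateau'.
Proof.
have c1 : continuous (fun t : R => t - 2).
  by move=> t; apply: cont_sub; [exact: cvg_id|exact: cst_continuous].
have c2 : continuous (fun t : R => - t - 2).
  move=> t; apply: cont_sub; last exact: cst_continuous.
  exact: opp_continuous.
have cf p (u : R -> R) : continuous u -> continuous (fun t => flat p (u t)).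
  by move=> cu t; apply: (@continuous_comp _ _ _ u (flat p)); [exact: cu|exact: continuous_flat].
move=> t; apply: cont_mul; last by apply: cont_sub; exact: cf.
apply: (cf _) => s; apply: cont_sub; last exact: cf.
by apply: cont_sub; [exact: cst_continuous|exact: cf].
Qed.

Lemma plateau_ge0 t : 0 <= plateau t.
Proof. exact: flat1_ge0. Qed.

Let f_le s t : 0 < t -> s <= t -> f s <= f t.
Proof. by move=> t0; rewrite le_eqVlt => /predU1P[->//|st]; rewrite ltW// flat1_lt. Qed.

Let far t : 3 <= `|t| -> f 1 - f (t - 2) - f (- t - 2) <= 0.
Proof.
rewrite ler_normr => /orP[] t3.
  rewrite (@flat_le0 _ _ (- t - 2)); last by lra.
  by rewrite subr0 subr_le0 f_le; lra.
rewrite (@flat_le0 _ _ (t - 2)); last by lra.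
by rewrite subr0 subr_le0 f_le; lra.
Qed.

Lemma plateau_far t : 3 <= `|t| -> plateau t = 0.
Proof. by move=> t3; rewrite /plateau flat_le0//; exact: far. Qed.

Lemma plateau'_far t : 3 <= `|t| -> plateau' t = 0.
Proof. by move=> t3; rewrite /plateau' flat_le0 ?mul0r//; exact: far. Qed.

Lemma plateau'_near t : `|t| <= 2 -> plateau' t = 0.
Proof.
rewrite ler_norml => /andP[t1 t2]; rewrite /plateau'.
rewrite (@flat_le0 _ (flat_deriv 1) (- t - 2)); last by lra.
rewrite (@flat_le0 _ (flat_deriv 1) (t - 2)); last by lra.
by rewrite subrr mulr0.
Qed.

Lemma plateau_gt0 : 0 < plateau 0.
Proof.
rewrite /plateau (@flat_le0 _ _ (0 - 2)) 1?(@flat_le0 _ _ (- 0 - 2)); try by lra.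
by rewrite !subr0 !flat1_gt0.
Qed.

Lemma plateau'_le0 t : 0 <= t -> plateau' t <= 0.
Proof.
move=> t0; rewrite /plateau' (@flat_le0 _ (flat_deriv 1) (- t - 2)); last by lra.
by rewrite sub0r mulrN oppr_le0 mulr_ge0// flat1_deriv_ge0.
Qed.

Lemma plateau'_lt0 : plateau' (5 / 2) < 0.
Proof.
rewrite /plateau' !(@flat_le0 _ _ (- (5 / 2) - 2)); try by lra.
rewrite sub0r mulrN oppr_lt0 mulr_gt0// flat1_deriv_gt0//; last by lra.
by rewrite subr0 subr_gt0 flat1_lt//; lra.
Qed.

(** Its support [-1, 1] is as wide as a hole, which is what lets [profile] jump only inside the
    holes. *)
Definition bump_fun (t : R) : R := f (1 + t) * f (1 - t).

Lemma bump_ge0 t : 0 <= bump_fun t.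
Proof. by rewrite mulr_ge0// flat1_ge0. Qed.

Lemma bump_gt0 : 0 < bump_fun 0.
Proof. by rewrite /bump_fun subr0 addr0 mulr_gt0// flat1_gt0. Qed.

Lemma bump_far t : 1 <= `|t| -> bump_fun t = 0.
Proof.
rewrite ler_normr /bump_fun => /orP[] h.
  by rewrite (@flat_le0 _ _ (1 - t)) ?mulr0//; lra.
by rewrite (@flat_le0 _ _ (1 + t)) ?mul0r//; lra.
Qed.

Lemma continuous_bump : continuous bump_fun.
Proof.
move=> t; apply: cont_mul.
  apply: (@continuous_comp _ _ _ (fun t : R => 1 + t) f); last exact: continuous_flat.
  by apply: cont_add; [exact: cst_continuous|exact: cvg_id].
apply: (@continuous_comp _ _ _ (fun t : R => 1 - t) f); last exact: continuous_flat.
by apply: cont_sub; [exact: cst_continuous|exact: cvg_id].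
Qed.

Lemma Cn_bump n d (c : R) (i : 'I_n) : Cn d (fun x => bump_fun (x 0 i - c)).
Proof.
have -> : (fun x : 'rV[R]_n => bump_fun (x 0 i - c)) =
    fun x => f ((1 - c) + 1 * x 0 i) * f ((1 + c) + -1 * x 0 i).
  by apply/funext => x; rewrite /bump_fun; congr (f _ * f _); ring.
by apply: Cn_mul; exact: Cn_flat.
Qed.

End plateau.

(** * Integration by parts with compact support *)

Section compact_support.
Variables (R : realType) (n : nat) (U S : set 'rV[R]_n).
Hypotheses (oU : open U) (cS : compact S) (SU : S `<=` U).
Implicit Types (f P : 'rV[R]_n -> R).

Lemma compact_closed_rV : closed S.
Proof. exact: compact_closed (@norm_hausdorff R 'rV[R]_n) cS. Qed.

Lemma compact_sub_cube : exists r, S `<=` cube 0 r.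
Proof.
have [M [_ MS]] := compact_bounded cS; exists (M + 1) => x /MS h i.
have /(_ (M + 1)) := h; rewrite ltrDl ltr01 => /(_ isT); apply: le_trans.
rewrite mxE sub0r normrN -[leRHS]/(mx_norm x) mx_normrE.
exact: (le_bigmax _ (fun ij => `|x ij.1 ij.2|) (0, i)).
Qed.

Lemma compact_lebesgue_rV : (@lebesgue_rV R n S < +oo)%E.
Proof.
have [r Sr] := compact_sub_cube; apply: le_lt_trans (lebesgue_rV_cube n r).
apply: le_measure => //; rewrite inE; apply: closed_measurable_rV.
  exact: compact_closed_rV.
exact: closed_cube.
Qed.

Lemma integrable_compact_support f : (forall x, U x -> continuous_at x f) ->
  (forall x, U x -> ~ S x -> f x = 0) ->
  (@lebesgue_rV R n).-integrable U (EFin \o f).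
Proof.
move=> cf f0.
apply: (@integrable_bounded_support _ _ _ (@lebesgue_rV R n) U S f) => //.
- exact: open_measurable_rV.
- by apply: closed_measurable_rV; exact: compact_closed_rV.
- exact: compact_lebesgue_rV.
- exact: measurable_fun_open_continuous.
have /compact_bounded[M [_ MB]] : compact (f @` S).
  apply: continuous_compact => //; apply: continuous_in_subspaceT => x /set_mem Sx.
  by apply: cf; exact: SU.
by exists M; split; [exact: num_real|move=> N MN x Sx; apply: MB => //; exists x].
Qed.

Lemma near_setC x : ~ S x -> nbhs x (~` S).
Proof.
move=> Sx; apply: open_nbhs_nbhs; split=> //.
by apply: closed_openC; exact: compact_closed_rV.
Qed.

(** The function f is controlled on U only, but f P vanishes off the compact set S inside U, so its
    i-th derivative is a continuous function on R^n with integral 0. Integrability is included so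
    that sums can be integrated term by term. *)
Lemma integration_by_parts (i : 'I_n) f P :
  (forall x, U x -> continuous_at x f) -> (forall x, U x -> derivable f x (delta_mx 0 i)) ->
  (forall x, U x -> continuous_at x (pderiv i f)) ->
  (forall x, continuous_at x P) -> (forall x, derivable P x (delta_mx 0 i)) ->
  (forall x, continuous_at x (pderiv i P)) -> (forall x, ~ S x -> P x = 0) ->
  (@lebesgue_rV R n).-integrable U (EFin \o (fun x => pderiv i f x * P x + f x * pderiv i P x)) /\
  (\int[@lebesgue_rV R n]_(x in U) (pderiv i f x * P x + f x * pderiv i P x)%:E = 0)%E.
Proof.
move=> cf df cdf cP dP cdP P0.
pose F x := f x * P x.
have F0 x : (~` S) x -> F x = 0 by move=> Sx; rewrite /F P0// mulr0.
have dP0 x : ~ S x -> pderiv i P x = 0.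
  move=> Sx; rewrite -[RHS]/((fun=> 0) x) -(pderiv_cst i 0).
  exact: (pderiv_near i (near_setC Sx) P0).2.
have dF0 x : ~ S x -> pderiv i F x = 0.
  move=> Sx; rewrite -[RHS]/((fun=> 0) x) -(pderiv_cst i 0).
  exact: (pderiv_near i (near_setC Sx) F0).2.
have dFU x : U x -> pderiv i F x = pderiv i f x * P x + f x * pderiv i P x.
  move=> Ux; rewrite addrC [X in _ + X]mulrC.
  exact: (deriveM (df x Ux) (dP x)).
have nU x : U x -> nbhs x U by move=> Ux; exact: open_nbhs_nbhs.
have contU x : U x -> continuous_at x (fun x => pderiv i f x * P x + f x * pderiv i P x).
  by move=> Ux; apply: cont_add; apply: cont_mul; [exact: cdf|exact: cP|exact: cf|exact: cdP].
have local0 (g : 'rV[R]_n -> R) x : (forall y, ~ S y -> g y = 0) -> ~ S x -> continuous_at x g.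
  by move=> g0 Sx; apply: (cont_near (near_setC Sx) g0); exact: cst_continuous.
split.
  apply: integrable_compact_support => // x Ux Sx /=.
  by rewrite P0// dP0// !mulr0 addr0.
have [r Sr] := compact_sub_cube.
rewrite -[RHS](@integral_pderiv0 R n i F r).
- rewrite integral_mkcond; apply: eq_integral => x _; rewrite patchE.
  case: ifPn => [/set_mem Ux|xU]; first by rewrite dFU.
  by rewrite dF0// => /SU Ux; move: xU; rewrite mem_set.
- move=> x; have [Sx|Sx] := pselect (S x); last exact: local0.
  by apply: cont_mul; [apply: cf; exact: SU|exact: cP].
- move=> x; have [Sx|Sx] := pselect (S x).
    exact: (derivableM (df x (SU Sx)) (dP x)).
  apply/(pderiv_near i (near_setC Sx) F0).1; exact: derivable_cst.
- move=> x; have [/SU Ux|Sx] := pselect (S x); last exact: local0.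
  exact: (cont_near (nU x Ux) dFU (contU x Ux)).
- by move=> x rx; apply: F0 => /Sr.
Qed.

End compact_support.

(** * Product cutoffs and Stokes' theorem *)

Section product_cutoff.
Variables (R : realType) (n : nat) (z : 'I_n -> R).
Implicit Types (x : 'rV[R]_n) (T D : {set 'I_n}).

(** The product of plateaus centred at z, differentiated once in each direction of T. Indexing by a
    set builds in the symmetry of second derivatives. *)
Definition cutoff T x : R :=
  \prod_l (if l \in T then @plateau' R else @plateau R) (x 0 l - z l).

Lemma cutoff_continuous T x : continuous_at x (cutoff T).
Proof.
apply: cont_prod => l _.
apply: (@continuous_comp _ _ _ (fun x : 'rV[R]_n => x 0 l - z l)
  (if l \in T then @plateau' R else @plateau R)).
  by apply: cont_sub; [exact: coord_continuous|exact: cst_continuous].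
by case: ifP => _; [exact: continuous_plateau'|exact: continuous_plateau].
Qed.

Lemma cutoff_pderiv T (i : 'I_n) x : i \notin T ->
  derivable (cutoff T) x (delta_mx 0 i) /\ pderiv i (cutoff T) x = cutoff (i |: T) x.
Proof.
move=> iT; pose v l : R -> R := if l \in T then @plateau' R else @plateau R.
have vi : v i = @plateau R by rewrite /v (negbTE iT).
have [|d ->] := @pderiv_prod_coord R n i v z x.
  by rewrite vi; have [] := is_derive_plateau (x 0 i - z i).
split=> //; apply: eq_bigr => l _; rewrite in_setU1 /v.
case: eqVneq => [->|_ //]; rewrite orTb (negbTE iT) derive1E.
exact: (@derive_val _ _ _ _ _ _ _ (is_derive_plateau _)).
Qed.

(** It contains the support of every cutoff differentiated in a direction of D, as [plateau']
    vanishes on [-2, 2]. *)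
Definition shell D : set 'rV[R]_n :=
  [set x | (forall l, `|x 0 l - z l| <= 3) /\ exists p, p \in D /\ 2 <= `|x 0 p - z p|].

Lemma cutoff_eq0 T D p x : p \in T -> p \in D -> ~ shell D x -> cutoff T x = 0.
Proof.
move=> pT pD /not_andP[/existsNP[l /negP]|/forallNP/(_ p)/not_andP[//|/negP]].
  rewrite -ltNge => /ltW l3; rewrite /cutoff (bigD1 l) //=.
  by case: ifP => _; rewrite ?plateau_far ?plateau'_far ?mul0r.
by rewrite -ltNge => /ltW p2; rewrite /cutoff (bigD1 p) //= pT plateau'_near ?mul0r.
Qed.

Lemma compact_shell D : compact (shell D).
Proof.
have -> : shell D = cube (\row_l z l) 3 `&`
    \bigcup_(p in [set` D]) ((fun x : 'rV[R]_n => `|x 0 p - z p|) @^-1` [set t | 2 <= t]).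
  apply/seteqP; split=> x.
    move=> [h [p [pD hp]]]; split; last by exists p.
    by move=> l; rewrite mxE distrC; exact: h.
  move=> [h [p pD hp]]; split; last by exists p.
  by move=> l; have := h l; rewrite mxE distrC.
apply: compact_closedI; first exact: compact_cube.
apply: closed_bigcup => [|p _]; first exact: finite_finset.
apply: closed_comp; last exact: closed_ge.
move=> x _; apply: cont_norm; apply: cont_sub; last exact: cst_continuous.
exact: coord_continuous.
Qed.

End product_cutoff.

Section vanishing.
Variables (R : realType) (n k : nat) (z : 'I_n -> R) (D : {set 'I_n}).
Variables (U : set 'rV[R]_n) (oU : open U) (SU : shell z D `<=` U).

(* The pairing of an exact form with the closed form d(cutoff) /\ ... vanishes, by Stokes. *)
Lemma integral_exact_cutoff (I : {ffun 'I_k.+2 -> 'I_n})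
    (c : 'rV[R]_n -> {ffun 'I_k -> 'I_n} -> R) : injective I -> (forall p, I p \in D) ->
  (forall J, smooth_on U (fun x => c x J)) ->
  let w x := \sum_(p < k.+2) (-1) ^+ p *
    (\sum_(q < k.+1) (-1) ^+ q * pderiv (face I p q) (fun y => c y (face (face I p) q)) x) *
    cutoff z [set I p]%SET x in
  (\int[@lebesgue_rV R n]_(x in U) (w x)%:E = 0)%E.
Proof.
move=> Iinj ID sc w.
pose g p q x := c x (face (face I p) q).
have Ipq p q : face I p q \notin [set I p]%SET.
  by rewrite finset.in_set1 ffunE (inj_eq Iinj) eq_sym neq_lift.
have cS : compact (shell z D) by exact: compact_shell.
pose h p q x := pderiv (face I p q) (g p q) x * cutoff z [set I p]%SET x +
   g p q x * pderiv (face I p q) (cutoff z [set I p]%SET) x.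
have ibp p q : (@lebesgue_rV R n).-integrable U (EFin \o h p q) /\
    (\int[@lebesgue_rV R n]_(x in U) (h p q x)%:E = 0)%E.
  have sg := sc (face (face I p) q).
  apply: (@integration_by_parts R n U (shell z D)) => //.
  - by move=> x Ux; have [] := sg [::] x Ux.
  - by move=> x Ux; have [_ /(_ (face I p q))] := sg [::] x Ux.
  - by move=> x Ux; have [] := sg [:: face I p q] x Ux.
  - exact: cutoff_continuous.
  - by move=> x; exact: (cutoff_pderiv z x (Ipq p q)).1.
  - move=> x.
    rewrite (_ : pderiv _ _ = cutoff z (face I p q |: [set I p]%SET)).
      exact: cutoff_continuous.
    by apply/funext => y; exact: (cutoff_pderiv z y (Ipq p q)).2.
  - by move=> x; apply: (@cutoff_eq0 _ _ _ _ _ (I p)); rewrite ?finset.in_set1 ?eqxx.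
(* The double sum with second derivatives of the cutoff is 0 by d d = 0; adding it completes each
   term to a total derivative [h p q]. *)
have wE x : w x = \sum_(p < k.+2) \sum_(q < k.+1) ((-1) ^+ p * (-1) ^+ q) * h p q x.
  have := @sum_face_face R n k I (c x) (fun p p' => cutoff z [set I p; I p']%SET x).
  move=> /(_ (fun p p' => congr1 (cutoff z ^~ x) (finset.setUC _ _))) E0.
  rewrite -[LHS]addr0 -[X in _ + X]E0 -big_split /=; apply: eq_bigr => p _.
  rewrite mulr_sumr mulr_suml -big_split /=; apply: eq_bigr => q _.
  rewrite /h (cutoff_pderiv z x (Ipq p q)).2 /g ffunE finset.setUC; ring.
have int2 (p : 'I_k.+2) (q : 'I_k.+1) : (@lebesgue_rV R n).-integrable U
    (EFin \o (fun x => ((-1) ^+ p * (-1) ^+ q) * h p q x)).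
  have := integrableZl (open_measurable_rV oU) ((-1) ^+ p * (-1) ^+ q) (ibp p q).1.
  by apply: eq_integrable => //; exact: open_measurable_rV.
rewrite (eq_integral (fun x => \sum_(pq : 'I_k.+2 * 'I_k.+1)
    (((-1) ^+ pq.1 * (-1) ^+ pq.2) * h pq.1 pq.2 x)%:E)%E); last first.
  by move=> x _; rewrite wE pair_bigA /= sumEFin.
rewrite integral_sum => [|//|[p q]].
- apply: big1 => -[p q] _ /=.
  under eq_integral do rewrite EFinM.
  by rewrite (integralZl _ (ibp p q).1) ?(ibp p q).2 ?mule0//; exact: open_measurable_rV.
- exact: open_measurable_rV.
- exact: int2.
Qed.

End vanishing.

(** * The bound of the pairing by the norm *)

(** The integral of a nonnegative function is a supremum over simple functions below it, hence
    monotone for arbitrary functions. Below, the norm density of an arbitrary [a] may fail to be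
    measurable. *)
Lemma ge0_le_integral_nonmeasurable d (T : measurableType d) (R : realType)
    (mu : {measure set T -> \bar R}) (D : set T) (f g : T -> \bar R) :
  (forall x, D x -> 0 <= f x)%E -> (forall x, D x -> f x <= g x)%E ->
  (\int[mu]_(x in D) f x <= \int[mu]_(x in D) g x)%E.
Proof.
move=> f0 fg.
have g0 x : D x -> (0 <= g x)%E by move=> Dx; apply: le_trans (f0 _ Dx) (fg _ Dx).
rewrite !ge0_integralE//; apply: le_ereal_sup => _ [h hf <-].
exists h => // x; apply: le_trans (hf x) _.
exact: lee_restrict.
Qed.

Section pairing_bound.
Variables (R : realType) (n k : nat) (U S : set 'rV[R]_n).
Hypotheses (oU : open U) (cS : compact S) (SU : S `<=` U).
Variables (G : 'rV[R]_n -> 'M[R]_n) (wt : 'rV[R]_n -> R).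
Hypotheses (Gsym : forall x, U x -> (G x)^T = G x)
  (Gpos : forall x (v : 'rV[R]_n), U x -> v != 0 -> 0 < (v *m G x *m v^T) 0 0)
  (Gcont : forall p q x, U x -> continuous_at x (fun x => G x p q))
  (wt_gt0 : forall x, U x -> 0 < wt x) (wt_cont : forall x, U x -> continuous_at x wt).
Variable e : 'rV[R]_n -> {ffun 'I_k -> 'I_n} -> R.
Hypotheses (e_cont : forall I x, continuous_at x (fun x => e x I))
  (e0 : forall x, ~ S x -> forall I, e x I = 0).

Let s x := wt x * Num.sqrt (\det (G x)) / k`!%:R.

Let s_gt0 x : U x -> 0 < s x.
Proof.
move=> Ux; rewrite divr_gt0 ?ltr0n ?fact_gt0// mulr_gt0 ?wt_gt0// sqrtr_gt0.
by apply: det_posdef_gt0 => [|v v0]; [exact: Gsym|exact: Gpos].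
Qed.

Let det_cont x : U x -> continuous_at x (fun x => \det (G x)).
Proof.
move=> Ux; apply: cont_sum => t _; apply: cont_mul; first exact: cst_continuous.
by apply: cont_prod => i _; exact: Gcont.
Qed.

Let s_cont x : U x -> continuous_at x s.
Proof.
move=> Ux; apply: cont_mul; last exact: cst_continuous.
apply: cont_mul; first exact: wt_cont.
apply: (@continuous_comp _ _ _ (fun x => \det (G x)) Num.sqrt); first exact: det_cont.
exact: sqrt_continuous.
Qed.

(** The part of the AM-GM bound that does not involve the form: it is continuous and supported in S,
    and its integral is the constant D. *)
Let dual x := (s x)^-1 * \sum_I \sum_J tensor (G x) I J * e x I * e x J.

Let dual_cont x : U x -> continuous_at x dual.
Proof.
move=> Ux; apply: cont_mul.
  by apply: cont_inv; [rewrite gt_eqF// s_gt0|exact: s_cont].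
apply: cont_sum => I _; apply: cont_sum => J _; do 2 (apply: cont_mul; last exact: e_cont).
by apply: cont_prod => p _; exact: Gcont.
Qed.

Let dual_integrable : (@lebesgue_rV R n).-integrable U (EFin \o dual).
Proof.
apply: (integrable_compact_support oU cS SU dual_cont) => x _ Sx.
rewrite /dual big1 ?mulr0// => I _; rewrite big1// => J _.
by rewrite !e0// !mulr0.
Qed.

(** The inequality 2 a.e <= s |a|^2 + |e|^2 / s is integrated with s the density of mu over k!. The
    additive form gives a D independent of [a] and still makes sense when the norm is infinite. *)
Lemma pairing_bound : exists D : R, forall a : 'rV[R]_n -> {ffun 'I_k -> 'I_n} -> R,
  (@lebesgue_rV R n).-integrable U (EFin \o (fun x => \sum_I a x I * e x I)) ->
  (2%:E * \int[@lebesgue_rV R n]_(x in U) (\sum_I a x I * e x I)%:E <=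
   \int[@lebesgue_rV R n]_(x in U)
     (wt x * (k`!%:R^-1 * \sum_I \sum_J tensor (invmx (G x)) I J * a x I * a x J) *
      Num.sqrt (\det (G x)))%:E + D%:E)%E.
Proof.
pose mu : {measure set 'rV[R]_n -> \bar R} := @lebesgue_rV R n.
have mU : measurable U by exact: open_measurable_rV.
have Dfin : (\int[mu]_(x in U) (dual x)%:E \is a fin_num)%E.
  exact: integrable_fin_num.
exists (fine (\int[mu]_(x in U) (dual x)%:E)%E) => a inta.
rewrite fineK//; set q := (X in (_ <= \int[_]_(x in U) X x + _)%E).
pose F x := 2 * (\sum_I a x I * e x I) - dual x.
have int2a : mu.-integrable U (EFin \o (fun x => 2 * (\sum_I a x I * e x I))).
  exact: (integrableZl mU 2 inta).
have Fq x : U x -> ((F x)%:E <= q x)%E /\ (0 <= q x)%E.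
  move=> Ux; have PG := posdef_factor (Gsym Ux) (fun v => Gpos Ux (v := v)).
  have sE b : wt x * (k`!%:R^-1 * b) * Num.sqrt (\det (G x)) = s x * b.
    by rewrite /s; ring.
  rewrite /q !lee_fin sE; split.
    by rewrite lerBlDr; exact: (tensor_amgm (a x) (e x) (s_gt0 Ux) PG).
  have := tensor_amgm (a x) (fun=> 0) (s_gt0 Ux) PG.
  rewrite [X in 2 * X]big1 ?mulr0 => [|I _]; last by rewrite mulr0.
  rewrite [X in _ + _ * X]big1 ?mulr0 ?addr0// => I _.
  by rewrite big1// => J _; rewrite mulr0.
have FE : (\int[mu]_(x in U) (F x)%:E = 2%:E * \int[mu]_(x in U) (\sum_I a x I * e x I)%:E -
    \int[mu]_(x in U) (dual x)%:E)%E.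
  rewrite -(integralZl mU inta) -(integralB mU int2a dual_integrable).
  by apply: eq_integral => x _.
(* F may change sign; its positive part is still below q, which is nonnegative. *)
have Fle : (\int[mu]_(x in U) (F x)%:E <= \int[mu]_(x in U) q x)%E.
  rewrite integralE; apply: (@le_trans _ _ (\int[mu]_(x in U) ((EFin \o F)^\+ x))%E).
    by rewrite geeDl// oppe_le0; apply: integral_ge0.
  apply: ge0_le_integral_nonmeasurable => // x Ux.
  by rewrite funeposE ge_max; have [h1 h2] := Fq x Ux; rewrite h1 h2.
by rewrite -leeBlDr// -FE.
Qed.

End pairing_bound.

(** * Classes and functionals attached to the holes of degree k *)

Section cohomology_classes.
Variables (R : realType) (n' k' : nat).
Hypothesis hk : (k'.+1 < n'.+2)%N.
Local Notation n := n'.+2.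
Local Notation k := k'.+1.
Local Notation U := (@holes_compl R n').
Implicit Types (x y : 'rV[R]_n) (i j : nat).

Let i1 : 'I_n := lift ord0 ord0.

(** Hole number j n + k has residue k modulo n, so its shape is the one for degree k. *)
Definition hole_pos j : R := 8 * (j * n + k)%:R.

Definition hole_center j (l : 'I_n) : R := if l == ord0 then hole_pos j else 0.

Definition hole_dirs : {set 'I_n} := [set l : 'I_n | (l <= k)%N]%SET.

Definition first_indices : {ffun 'I_k.+1 -> 'I_n} := [ffun p => widen_ord hk p].

(* The indices 0, 2, 3, ..., k. *)
Definition class_indices : {ffun 'I_k -> 'I_n} := face first_indices (lift ord0 ord0).

Local Notation I0 := first_indices.
Local Notation J := class_indices.

Lemma first_indices_inj : injective I0.
Proof. by move=> p q; rewrite !ffunE => /(congr1 val) /= /val_inj. Qed.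

Lemma first_indices_dirs p : I0 p \in hole_dirs.
Proof. by rewrite finset.inE ffunE /=; have := ltn_ord p; rewrite ltnS. Qed.

Lemma class_indices_inj : injective J.
Proof. by move=> p q; rewrite [J p]ffunE [J q]ffunE => /first_indices_inj/lift_inj. Qed.

Lemma class_indices0 : J ord0 = ord0.
Proof. by rewrite !ffunE; apply/val_inj. Qed.

Lemma first_indices1 : I0 (lift ord0 ord0) = i1.
Proof. by rewrite ffunE; apply/val_inj. Qed.

Lemma class_indices_neq q : i1 != J q.
Proof.
by rewrite -first_indices1 [J q]ffunE (inj_eq first_indices_inj) neq_lift.
Qed.

Lemma class_indices_dirs (l : 'I_n) : l \in hole_dirs -> l != i1 -> exists q, l = J q.
Proof.
rewrite finset.inE => lk li1; have lk' : (l < k.+1)%N by rewrite ltnS.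
have : lift ord0 ord0 != Ordinal lk'.
  by apply: contraNneq li1 => /(congr1 val) /= h; apply/eqP/val_inj.
move=> /unlift_some[q qE _]; exists q.
by rewrite [J q]ffunE -qE ffunE; apply/val_inj.
Qed.

(** The sums of radii compared later are 2 + 2 and 1 + 3, both below 8. *)
Lemma hole_pos_sep i j : `|hole_pos i - hole_pos j| < 8 -> i = j.
Proof.
have lt_sep a b : (a < b)%N -> 8 <= hole_pos b - hole_pos a.
  move=> ab; have : ((a * n + k).+1%:R <= (b * n + k)%:R :> R).
    by rewrite ler_nat; have := leq_mul ab (leqnn n); rewrite mulSn; lia.
  by rewrite /hole_pos -natr1; lra.
have [/lt_sep h|/lt_sep h|//] := ltngtP i j; rewrite ltr_norml => /andP[h1 h2];
  exfalso; lra.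
Qed.

(** Coordinate 0 stays within 3 of [hole_pos j], hence at least 5 away from the centre of any other
    hole. The j-th hole itself is left by the coordinate at distance at least 2, which is one of
    those bounding that hole. *)
Lemma shell_sub_holes_compl j : shell (hole_center j) hole_dirs `<=` U.
Proof.
move=> x [x3 [p [pk xp]]] m m0.
have := x3 ord0; rewrite /hole_center eqxx => x03.
have [mE|mj] := eqVneq m (j * n + k)%N; last first.
  left; have : 1 <= `|m%:R - (j * n + k)%:R| :> R.
    have [mj'|mj'|] := ltngtP m (j * n + k)%N; last by move/eqP: mj.
      have : (m.+1%:R <= (j * n + k)%:R :> R) by rewrite ler_nat.
      by rewrite -natr1 ler_normr => h; apply/orP; right; lra.
    have : ((j * n + k).+1%:R <= m%:R :> R) by rewrite ler_nat.
    by rewrite -natr1 ler_normr => h; apply/orP; left; lra.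
  move: x03; rewrite /hole_pos ler_norml => /andP[h1 h2].
  by rewrite ler_normr ltr_normr => /orP[] h; apply/orP; [right|left]; lra.
have mk : (m %% n)%N = k by rewrite mE modnMDl modn_small.
move: xp; rewrite /hole_center; case: eqVneq => [->|p0] xp; [left|right].
  by rewrite mE; apply: lt_le_trans xp; rewrite ltr1n.
rewrite subr0 in xp; exists p; split; last by apply: lt_le_trans xp; rewrite ltr1n.
by move: pk; rewrite mk finset.inE lt0n => ->; rewrite andbT.
Qed.

Definition bumps j x : R := \prod_(q < k) bump_fun (x 0 (J q) - hole_center j (J q)).

Lemma bumps_far j x (q : 'I_k) : 1 <= `|x 0 (J q) - hole_center j (J q)| -> bumps j x = 0.
Proof. by move=> h; rewrite /bumps (bigD1 q) //= bump_far// mul0r. Qed.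

Lemma bumps_far0 j x : 1 <= `|x 0 ord0 - hole_pos j| -> bumps j x = 0.
Proof. by move=> h; apply: (@bumps_far _ _ ord0); rewrite class_indices0. Qed.

Lemma Cn_bumps d j : Cn d (bumps j).
Proof. by apply: Cn_prod => q; exact: Cn_bump. Qed.

Lemma pderiv_bumps j (l : 'I_n) x : (forall q, l != J q) -> pderiv l (bumps j) x = 0.
Proof.
move=> lJ; have [|_] := derive_along (f := bumps j) (a := x) (v := delta_mx 0 l)
    (g := cst (bumps j x : R^o)) (b := (0 : R^o)) (w := (0 : R^o)).
  move=> h; apply: eq_bigr => q _; congr bump_fun.
  by rewrite !mxE eqxx eq_sym (negbTE (lJ q)) mulr0 add0r.
by rewrite /pderiv => ->; exact: derive_cst.
Qed.

(** The radius 2 exceeds the radius 1 of the bumps, so the index is locally constant around their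
    supports; where the default 0 is taken, [bumps 0] vanishes. *)
Definition nearest_hole x : nat := xget 0%N [set j | `|x 0 ord0 - hole_pos j| <= 2].

Lemma nearest_holeE j x : `|x 0 ord0 - hole_pos j| <= 2 -> nearest_hole x = j.
Proof.
move=> h; apply: hole_pos_sep.
have : [set j | `|x 0 ord0 - hole_pos j| <= 2] (nearest_hole x) by apply: xgetPex; exists j.
move: h => /=; rewrite !ler_norml => /andP[h1 h2] /andP[h3 h4].
by rewrite ltr_norml; apply/andP; split; lra.
Qed.

(* The coefficient of a closed k-form dual to the half spaces {x_i = 0 for i = 0, 2, ..., k; x_1 > 0} starting at the holes; it is smooth only because the holes are removed. *)
Definition profile (c : nat -> R) x : R :=
  if 0 < x 0 i1 then c (nearest_hole x) * bumps (nearest_hole x) x else 0.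

(** A jump could occur only at x_1 = 0 inside the support of the bumps, that is, in a hole. Near a
    point of U either coordinate 0 or another coordinate of [J] makes the bumps vanish, or the sign
    of x_1 is constant. *)
Lemma profile_local c x : U x ->
  exists C j, \forall y \near x, profile c y = C * bumps j y.
Proof.
move=> Ux.
have near_gt (f : 'rV[R]_n -> R) (r : R) : continuous f -> r < f x -> nbhs x [set y | r < f y].
  by move=> cf fx; exact: cf (lt_nbhsr fx).
have cc (l : 'I_n) (r : R) : continuous (fun y : 'rV[R]_n => `|y 0 l - r|).
  move=> y; apply: cont_norm; apply: cont_sub; last exact: cst_continuous.
  exact: coord_continuous.
have cN (l : 'I_n) : continuous (fun y : 'rV[R]_n => - y 0 l).
  by move=> y; apply: (@continuous_comp _ _ _ (fun y : 'rV[R]_n => y 0 l) -%R);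
    [exact: coord_continuous|exact: opp_continuous].
have [[j xj]|xj] := pselect (exists j, `|x 0 ord0 - hole_pos j| < 2); last first.
  exists 0, 0%N; apply/nbhs_rVP; exists 1 => // y /(_ ord0) xy.
  rewrite mul0r /profile; case: ifP => // _; rewrite bumps_far0 ?mulr0//.
  have x2 : 2 <= `|x 0 ord0 - hole_pos (nearest_hole y)|.
    by rewrite leNgt; apply/negP => h; apply: xj; exists (nearest_hole y).
  move: x2 xy; rewrite !ler_normr ltr_norml => /orP[] h /andP[h1 h2]; apply/orP; [left|right]; lra.
have nearj : nbhs x [set y : 'rV[R]_n | nearest_hole y = j].
  apply/nbhs_rVP; exists (2 - `|x 0 ord0 - hole_pos j|); first by rewrite subr_gt0.
  move=> y /(_ ord0) xy; apply: nearest_holeE.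
  rewrite (_ : _ - _ = (x 0 ord0 - hole_pos j) - (x 0 ord0 - y 0 ord0)); last by ring.
  by apply: le_trans (ler_normB _ _) _; lra.
have mk : ((j * n + k) %% n = k)%N by rewrite modnMDl modn_small.
have [|x1|[l [lk xl]]] := Ux (j * n + k)%N.
- by rewrite mk.
- exists 0, j; have := near_gt _ 1 (cc ord0 (hole_pos j)) x1.
  apply: filterS2 nearj => y jy /= hy; rewrite mul0r /profile jy; case: ifP => // _.
  by rewrite bumps_far0 ?mulr0// ltW.
- rewrite mk in lk.
  have [li1|li1] := eqVneq l i1; last first.
    have [q lq] : exists q, l = J q by apply: class_indices_dirs => //; rewrite finset.inE; case/andP: lk.
    exists 0, j; have := near_gt _ 1 (cc l 0).
    rewrite subr0 => /(_ xl); apply: filterS2 nearj => y jy /= hy.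
    rewrite mul0r /profile jy; case: ifP => // _; rewrite (@bumps_far _ _ q) ?mulr0//.
    rewrite -lq /hole_center ifF ?ltW//; apply/eqP => l0.
    by move: lk; rewrite l0.
  move: xl; rewrite li1 ltr_normr => /orP[] xl.
    exists (c j), j; have := near_gt _ 0 (@coord_continuous _ _ _ 0 i1).
    move=> /(_ _)/=; rewrite (lt_trans ltr01 xl) => /(_ isT).
    by apply: filterS2 nearj => y jy /= hy; rewrite /profile hy jy.
  exists 0, j; have := near_gt _ 0 (cN i1) (lt_trans ltr01 xl).
  apply: filterS => y /= hy; rewrite mul0r /profile ifF//.
  by apply/negbTE; rewrite -leNgt -oppr_ge0 ltW.
Qed.

Local Notation M := (open_submanifold (@open_holes_compl R n') (@holes_compl_nonempty R n')).

Definition class_form (c : nat -> R) : form_field R n k :=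
  fun _ x I => profile c x * wedge R J I.

Lemma profile_local_Cn c (w : R) x : U x -> exists g, [/\ forall d, Cn d g,
  \forall y \near x, profile c y * w = g y &
  forall l, (forall q, l != J q) -> pderiv l g x = 0].
Proof.
move=> Ux; have [C [j Cj]] := profile_local c Ux.
exists (fun y => (C * w) * bumps j y); split=> [d||l lJ].
- by apply: Cn_mul; [exact: Cn_cst|exact: Cn_bumps].
- by apply: filterS Cj => y ->; ring.
have db : derivable (bumps j) x (delta_mx 0 l).
  by have [_ /(_ l)[]] := Cn_bumps 1 j.
have dc : derivable (cst (C * w) : 'rV[R]_n -> R) x (delta_mx 0 l) by exact: derivable_cst.
rewrite /pderiv (deriveM dc db) derive_cst scaler0 addr0.
by rewrite -[X in _ *: X]/(pderiv l (bumps j) x) pderiv_bumps ?scaler0.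
Qed.

Lemma class_form_smooth c I : smooth_on U (fun x => class_form c 0 x I).
Proof.
apply: smooth_on_local => x Ux; have [g [Cg fg _]] := profile_local_Cn c (wedge R J I) Ux.
by exists g; split=> //; exact: Cn_smooth.
Qed.

(** Locally the profile is a multiple of [bumps j], a function of the coordinates in [J] only, so
    its differential is killed by the wedge with dx_J. *)
Lemma class_form_closed c : closed_form M (class_form c).
Proof.
have ov i j x : overlap M i j x -> [/\ i = 0%N, j = 0%N & U x].
  exact: overlap_open_submanifold.
split; first split.
- split=> [i x I s _|i j x I /ov[-> -> Ux]].
    by rewrite /class_form wedge_perm mulrCA.
  rewrite transition_open_submanifold// tjac_open_submanifold//.
  under eq_bigr => I' _ do rewrite -/(tensor 1%:M I I') tensor1.
  rewrite (bigD1 I) //= eqxx mul1r big1 ?addr0// => I' I'I.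
  by rewrite eq_sym (negbTE I'I) mul0r.
- move=> i I; rewrite cod_open_submanifold; case: i => [|i]; last by move=> s x [].
  exact: class_form_smooth.
move=> i x I; rewrite cod_open_submanifold; case: i => // Ux.
rewrite /ext_d /zero_form.
have [g [Cg fg g0]] := profile_local_Cn c 1 Ux.
have near_x : nbhs x [set y | profile c y * 1 = g y] by [].
have dp (l : 'I_n) : derivable (profile c) x (delta_mx 0 l) /\
    ((forall q, l != J q) -> pderiv l (profile c) x = 0).
  have pg y : [set y | profile c y * 1 = g y] y -> profile c y = g y by move=> /= <-; rewrite mulr1.
  have [dE ->] := pderiv_near l near_x pg; split; last exact: g0.
  by apply/dE; have [_ /(_ l)[]] := Cg 1%N.
rewrite -[RHS](@sum_wedge_face R n k J I (fun l => pderiv l (profile c) x)).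
- apply: eq_bigr => p _; congr (_ * _); set w := wedge R J (face I p).
  have dc : derivable (cst w : 'rV[R]_n -> R) x (delta_mx 0 (I p)) by exact: derivable_cst.
  have := deriveM (dp (I p)).1 dc.
  by rewrite derive_cst scaler0 add0r => E; rewrite mulrC; exact: E.
- exact: class_indices_inj.
- by move=> l; exact: (dp l).2.
Qed.

(** The coefficients of L_j. They are not antisymmetrised: they sit on the increasing faces of (0,
    ..., k) only, so the sum over all k-tuples meets each component once. *)
Definition dual_form j x (I : {ffun 'I_k -> 'I_n}) : R :=
  \sum_(p < k.+1) (I == face I0 p)%:R *
    ((-1) ^+ p * cutoff (hole_center j) [set I0 p]%SET x).

Lemma sum_dual_form j x (a : {ffun 'I_k -> 'I_n} -> R) :
  \sum_I a I * dual_form j x I =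
  \sum_(p < k.+1) (-1) ^+ p * a (face I0 p) * cutoff (hole_center j) [set I0 p]%SET x.
Proof.
under eq_bigr => I _ do rewrite mulr_sumr.
rewrite exchange_big /=; apply: eq_bigr => p _.
rewrite (bigD1 (face I0 p)) //= eqxx mul1r big1 ?addr0; first by ring.
by move=> I /negbTE ->; rewrite mul0r mulr0.
Qed.

Lemma dual_form_cont j I x : continuous_at x (fun x => dual_form j x I).
Proof.
apply: cont_sum => p _; apply: cont_mul; first exact: cst_continuous.
by apply: cont_mul; [exact: cst_continuous|exact: cutoff_continuous].
Qed.

Lemma dual_form_eq0 j x : ~ shell (hole_center j) hole_dirs x ->
  forall I, dual_form j x I = 0.
Proof.
move=> Sx I; apply: big1 => p _.
rewrite (@cutoff_eq0 _ _ _ _ hole_dirs (I0 p)) ?mulr0 ?first_indices_dirs//.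
by rewrite finset.in_set1.
Qed.

Lemma dual_form_integrable j (a : 'rV[R]_n -> {ffun 'I_k -> 'I_n} -> R) :
  (forall I x, U x -> continuous_at x (fun x => a x I)) ->
  (@lebesgue_rV R n).-integrable U (EFin \o (fun x => \sum_I a x I * dual_form j x I)).
Proof.
move=> ca; apply: (@integrable_compact_support R n U (shell (hole_center j) hole_dirs)).
- exact: open_holes_compl.
- exact: compact_shell.
- exact: shell_sub_holes_compl.
- by move=> x Ux; apply: cont_sum => I _; apply: cont_mul; [exact: ca|exact: dual_form_cont].
- by move=> x _ Sx; apply: big1 => I _; rewrite dual_form_eq0// mulr0.
Qed.

(** The pairing density of the j-th class is a product of functions of one variable. The plateau
    decreases for t > 0, so the minus sign makes every factor nonnegative. *)
Definition pairing_factor j (l : 'I_n) (t : R) : R :=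
  if l == i1 then (if 0 < t then - plateau' t else 0)
  else (if [exists q, l == J q] then bump_fun (t - hole_center j l) else 1) *
       plateau (t - hole_center j l).

(** The truncation at t = 0 is harmless because [plateau'] vanishes on [-2, 2]. *)
Lemma continuous_pairing_factor j l : continuous (pairing_factor j l).
Proof.
have csub (r : R) (u : R -> R) : continuous u -> continuous (fun t : R => u (t - r)).
  move=> cu t; apply: (@continuous_comp _ _ _ (fun t : R => t - r) u); last exact: cu.
  by apply: cont_sub; [exact: cvg_id|exact: cst_continuous].
move=> t; rewrite /pairing_factor; case: eqVneq => _; last first.
  apply: cont_mul; last exact: (csub _ _ (@continuous_plateau R)).
  case: [exists q, l == J q]; last exact: cst_continuous.
  exact: (csub _ _ (@continuous_bump R)).
have cN : continuous (fun t : R => - plateau' t).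
  move=> s; apply: (@continuous_comp _ _ _ (@plateau' R) -%R).
    exact: continuous_plateau'.
  exact: opp_continuous.
have [t0|t0] := ltP 0 t.
  apply: (@cont_near _ _ _ (fun t : R => - plateau' t) _ [set s | 0 < s]).
  - exact: lt_nbhsr.
  - by move=> s /= ->.
  - exact: cN.
apply: (@cont_near R R _ (fun=> 0) _ [set s : R | s < 1]).
- by apply: lt_nbhsl; exact: le_lt_trans t0 ltr01.
- move=> s /= s1; case: ifP => // s0; rewrite plateau'_near ?oppr0//.
  by rewrite ger0_norm; lra.
- exact: cst_continuous.
Qed.

Lemma pairing_factor_ge0 j l t : 0 <= pairing_factor j l t.
Proof.
rewrite /pairing_factor; case: eqVneq => _.
  by case: ifP => // t0; rewrite oppr_ge0 plateau'_le0// ltW.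
by rewrite mulr_ge0 ?plateau_ge0//; case: ifP => // _; exact: bump_ge0.
Qed.

Lemma pairing_factor_gt0 j l : exists t, 0 < pairing_factor j l t.
Proof.
rewrite /pairing_factor; case: eqVneq => _.
  by exists (5 / 2); rewrite ifT ?oppr_gt0 ?plateau'_lt0//; lra.
exists (hole_center j l); rewrite subrr mulr_gt0 ?plateau_gt0//.
by case: ifP => // _; exact: bump_gt0.
Qed.

Lemma pairing_factor_prod j x : 0 < x 0 i1 ->
  \prod_l pairing_factor j l (x 0 l) = - (bumps j x * cutoff (hole_center j) [set i1]%SET x).
Proof.
move=> x1; rewrite /cutoff (bigD1 i1) //= [X in - (_ * X)](bigD1 i1) //=.
have c1 : hole_center j i1 = 0 by [].
rewrite finset.in_set1 eqxx /pairing_factor eqxx x1 c1 subr0.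
rewrite [X in _ * X](_ : _ = bumps j x * \prod_(l | l != i1) plateau (x 0 l - hole_center j l)).
  rewrite [X in _ = - (_ * (_ * X))](eq_bigr (fun l => plateau (x 0 l - hole_center j l))).
    by ring.
  by move=> l li1; rewrite finset.in_set1 (negbTE li1).
under eq_bigr => l li1 do rewrite (negbTE li1).
rewrite big_split /=; congr (_ * _); rewrite -big_mkcondr /=.
rewrite /bumps -(big_map J xpredT (fun l => bump_fun (x 0 l - hole_center j l))) /=.
rewrite -[LHS]big_filter; apply: perm_big; apply: uniq_perm.
- by rewrite filter_uniq// index_enum_uniq.
- by rewrite map_inj_uniq ?index_enum_uniq//; exact: class_indices_inj.
move=> l; rewrite mem_filter mem_index_enum andbT; apply/andP/mapP.
  by case=> _ /existsP[q /eqP lq]; exists q => //; rewrite mem_index_enum.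
case=> q _ ->; split; last by apply/existsP; exists q.
by rewrite eq_sym class_indices_neq.
Qed.

(** Only the face omitting index 1 contributes, since [J] avoids that index. The bumps of another
    hole do not meet the cutoff around the j-th one, which leaves the single coefficient c_j. *)
Lemma class_form_pairing c j x : U x ->
  \sum_I class_form c 0 x I * dual_form j x I = c j * \prod_l pairing_factor j l (x 0 l).
Proof.
move=> Ux; rewrite sum_dual_form (bigD1 (lift ord0 ord0)) //= big1 ?addr0.
  rewrite /class_form wedge_id ?mulr1; last exact: class_indices_inj.
  rewrite first_indices1 expr1 mulN1r /profile; case: ifP => x1; last first.
    by rewrite oppr0 mul0r (bigD1 i1) //= /pairing_factor eqxx x1 mul0r mulr0.
  rewrite pairing_factor_prod//.
  have [xj|xj] := ltP `|x 0 ord0 - hole_pos j| 1.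
    by rewrite (@nearest_holeE j) ?mulrN ?mulNr ?mulrA// ltW// (lt_trans xj)// ltr1n.
  rewrite [bumps j x]bumps_far0// mul0r oppr0 mulr0.
  set j' := nearest_hole x; have [xj'|xj'] := ltP `|x 0 ord0 - hole_pos j'| 1; last first.
    by rewrite bumps_far0// mulr0 oppr0 mul0r.
  have jj' : j' != j by apply: contraTneq xj' => ->; rewrite -leNgt.
  rewrite /cutoff (bigD1 ord0) //= finset.in_set1 /= /hole_center eqxx plateau_far ?mul0r ?mulr0//.
  rewrite leNgt; apply: contraNN jj' => h; apply/eqP/hole_pos_sep.
  by move: xj' h; rewrite !ltr_norml => /andP[h1 h2] /andP[h3 h4]; apply/andP; split; lra.
move=> p p1; have [r rE _] := unlift_some p1.
rewrite /class_form (@wedge_eq0 _ _ _ _ _ r) ?mulr0 ?mul0r// => q.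
by rewrite ffunE -rE first_indices1 class_indices_neq.
Qed.

Lemma pairing_integral j : exists ell : R, 0 < ell /\ forall c,
  (\int[@lebesgue_rV R n]_(x in U) (\sum_I class_form c 0 x I * dual_form j x I)%:E =
   (c j * ell)%:E)%E.
Proof.
pose G x := \prod_l pairing_factor j l (x 0 l).
have cG x : continuous_at x G.
  apply: cont_prod => l _.
  apply: (@continuous_comp _ _ _ (fun x : 'rV[R]_n => x 0 l) (pairing_factor j l)).
    exact: coord_continuous.
  exact: continuous_pairing_factor.
have G0 x : ~ shell (hole_center j) hole_dirs x -> G x = 0.
  move=> Sx; have [x1|x1] := ltP 0 (x 0 i1); last first.
    by rewrite /G (bigD1 i1) //= /pairing_factor eqxx ltNge x1 mul0r.
  rewrite /G pairing_factor_prod// (@cutoff_eq0 _ _ _ _ hole_dirs i1) ?mulr0 ?oppr0//.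
    by rewrite finset.in_set1.
  by rewrite finset.inE.
have mU : measurable U by apply: open_measurable_rV; exact: open_holes_compl.
have intG : (@lebesgue_rV R n).-integrable U (EFin \o G).
  apply: (@integrable_compact_support R n U (shell (hole_center j) hole_dirs)) => //.
  - exact: open_holes_compl.
  - exact: compact_shell.
  - exact: shell_sub_holes_compl.
  - by move=> x _; exact: G0.
have GE : (\int[@lebesgue_rV R n]_(x in U) (G x)%:E = \int[@lebesgue_rV R n]_x (G x)%:E)%E.
  rewrite integral_mkcond; apply: eq_integral => x _; rewrite patchE; case: ifPn => // xU.
  by rewrite G0// => /shell_sub_holes_compl Ux; move: xU; rewrite mem_set.
have fG : (\int[@lebesgue_rV R n]_(x in U) (G x)%:E \is a fin_num)%E.
  exact: integrable_fin_num.
exists (fine (\int[@lebesgue_rV R n]_(x in U) (G x)%:E)%E); split=> [|c].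
  rewrite fine_gt0// GE ltey_eq -GE fG andbT GE.
  apply: integral_prod_gt0 => l; [exact: continuous_pairing_factor|exact: pairing_factor_ge0|].
  exact: pairing_factor_gt0.
rewrite EFinM fineK// -(integralZl mU intG); apply: eq_integral => x /set_mem Ux.
by rewrite class_form_pairing.
Qed.

Lemma exact_pairing_eq0 j (b : form_field R n k') (a : 'rV[R]_n -> {ffun 'I_k -> 'I_n} -> R) :
  smooth_form M b -> (forall x I, U x -> a x I = ext_d b 0 x I) ->
  (\int[@lebesgue_rV R n]_(x in U) (\sum_I a x I * dual_form j x I)%:E = 0)%E.
Proof.
move=> [_ sb] ab.
have sb0 I : smooth_on U (fun x => b 0%N x I).
  by have := sb 0%N I; rewrite cod_open_submanifold.
rewrite -[RHS](@integral_exact_cutoff R n k' (hole_center j) hole_dirs U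
  (@open_holes_compl R n') (@shell_sub_holes_compl j) I0 (b 0%N)) //.
- apply: eq_integral => x /set_mem Ux; rewrite sum_dual_form; congr EFin.
  by apply: eq_bigr => p _; rewrite ab.
- exact: first_indices_inj.
- exact: first_indices_dirs.
Qed.

Lemma natural_map_not_surjective (g : metric_field R n) (h : M -> R) :
  riemannian M g -> smooth_function h ->
  ~ set_surj (harmonic_space g h k) (deRham_cohomology M k) (natural_map M k).
Proof.
move=> [gs gsym gpos _] hs surj.
pose mu : {measure set 'rV[R]_n -> \bar R} := @lebesgue_rV R n.
have oU := @open_holes_compl R n'.
have mU : measurable U by exact: open_measurable_rV.
have cod0 : cod M 0 = U by exact: cod_open_submanifold.
have wcont x : U x -> continuous_at x (weight h 0).
  move=> Ux.
  have ch : continuous_at x (h \o Defs.param M 0).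
    by have := hs 0%N; rewrite cod0 => /(_ [::] x Ux)[].
  apply: (@continuous_comp _ _ _ (fun x => 2 * h (Defs.param M 0 x)) expR).
    by apply: cont_mul; [exact: cst_continuous|exact: ch].
  exact: continuous_expR.
have bound j := @pairing_bound R n k U (shell (hole_center j) hole_dirs) oU
  (@compact_shell _ _ _ _) (@shell_sub_holes_compl j) (g 0%N) (weight h 0).
have /choice[D HD] : forall j, exists D : R, forall a : 'rV[R]_n -> {ffun 'I_k -> 'I_n} -> R,
    mu.-integrable U (EFin \o (fun x => \sum_I a x I * dual_form j x I)) ->
    (2%:E * \int[mu]_(x in U) (\sum_I a x I * dual_form j x I)%:E <=
     \int[mu]_(x in U) (weight h 0 x * (k`!%:R^-1 *
       \sum_I \sum_I' tensor (invmx (g 0%N x)) I I' * a x I * a x I') *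
       Num.sqrt (\det (g 0%N x)))%:E + D%:E)%E.
  move=> j; apply: (bound j).
  - by move=> x Ux; apply: gsym; rewrite cod0.
  - by move=> x v Ux; apply: gpos; rewrite cod0.
  - by move=> p q x Ux; have := gs 0%N p q; rewrite cod0 => /(_ [::] x Ux)[].
  - by move=> x _; exact: expR_gt0.
  - exact: wcont.
  - by move=> I x; exact: dual_form_cont.
  - by move=> x Sx I; exact: dual_form_eq0.
have /choice[ell ellP] := pairing_integral.
have ell_gt0 j : 0 < ell j by exact: (ellP j).1.
(* The division makes the j-th functional equal to |D_j| + j on the class. *)
pose c j := (`|D j| + j%:R) / ell j.
have bcl := class_form_closed c.
have [|al [[[afm ams _] aN] _ _] Eal] := surj (deRham_class M (class_form c)).
  by exists (class_form c).
(* The class contains its own representative, with primitive 0; read through the natural map, this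
   membership yields a smooth closed [a'] equal to [al] almost everywhere and cohomologous to
   [class_form c]. *)
have : deRham_class M (class_form c) (class_form c).
  split=> //; exists (@zero_form R n k').
    split; first split.
    - by move=> i x I t _; rewrite /zero_form mulr0.
    - by move=> i j x I _; rewrite big1// => I' _; rewrite mulr0.
    - by move=> i I t x _; exact: (@Cn_smooth R n (fun=> 0) (fun d => @Cn_cst R n d 0) t x Logic.I).
  move=> i x I _; rewrite /sub_form subrr /ext_d big1// => p _.
  by rewrite pderiv_cst mulr0.
rewrite -Eal => -[a' [[[_ a's] _] aa' [_ [b bsm bE]]]].
have a'cont I x : U x -> continuous_at x (fun x => a' 0%N x I).
  by move=> Ux; have := a's 0%N I; rewrite cod0 => /(_ [::] x Ux)[].
have bcont I x : U x -> continuous_at x (fun x => class_form c 0 x I).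
  by move=> Ux; have [] := @class_form_smooth c I [::] x Ux.
have inta' j := dual_form_integrable j a'cont.
have intb j := dual_form_integrable j bcont.
have a'E j : (\int[mu]_(x in U) (\sum_I a' 0%N x I * dual_form j x I)%:E = (c j * ell j)%:E)%E.
  rewrite -(ellP j).2.
  have := @exact_pairing_eq0 j b (fun x I => class_form c 0 x I - a' 0%N x I) bsm.
  have bE' x I : U x -> class_form c 0 x I - a' 0%N x I = ext_d b 0 x I.
    by move=> Ux; rewrite -bE ?cod0.
  move=> /(_ bE').
  under eq_integral => x _.
    rewrite (_ : \sum_I _ = \sum_I class_form c 0 x I * dual_form j x I -
        \sum_I a' 0%N x I * dual_form j x I); last first.
      by rewrite -sumrB; apply: eq_bigr => I _; rewrite mulrBl.
    rewrite EFinB; over.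
  rewrite (integralB mU (intb j) (inta' j)) => /eqP.
  by rewrite sube_eq ?add0e ?fin_num_adde_defl ?integrable_fin_num// => /eqP <-.
have mal j : measurable_fun U (EFin \o (fun x => \sum_I al 0%N x I * dual_form j x I)).
  apply/measurable_EFinP; apply: measurable_sum => I; apply: measurable_funM.
    by have := ams 0%N I; rewrite cod0.
  by apply: measurable_fun_open_continuous => // x _; exact: dual_form_cont.
(* Integrability and the value of the pairing pass from the smooth [a'] to the merely Borel [al]. *)
have ae_al j : ae_eq mu U (EFin \o (fun x => \sum_I al 0%N x I * dual_form j x I))
    (EFin \o (fun x => \sum_I a' 0%N x I * dual_form j x I)).
  have : {ae mu, forall x, forall I, cod M 0 x -> al 0%N x I = a' 0%N x I}.
    by apply: filter_forall => I; exact: aa'.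
  apply: filterS => x H Ux /=; congr EFin; apply: eq_bigr => I _.
  by rewrite H// cod0.
have ma' j := measurable_int mu (inta' j).
have intal j : mu.-integrable U (EFin \o (fun x => \sum_I al 0%N x I * dual_form j x I)).
  apply/integrableP; split=> //; have /integrableP[_] := inta' j; apply: le_lt_trans.
  rewrite le_eqVlt; apply/orP; left; apply/eqP; apply: ae_eq_integral => //.
  - by apply: measurableT_comp => //; exact: mal.
  - by apply: measurableT_comp => //; exact: ma'.
  - by apply: filterS (ae_al j) => x H Ux; exact: (congr1 abse (H Ux)).
have alE j : (\int[mu]_(x in U) (\sum_I al 0%N x I * dual_form j x I)%:E = (c j * ell j)%:E)%E.
  apply: etrans (a'E j); apply: ae_eq_integral => //.
  - exact: mal.
  - exact: ma'.
  - exact: ae_al.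
move: aN; rewrite /integral_mu integral_vol_open_submanifold => aN.
have ineq j := HD j _ (intal j).
move: aN ineq.
set N := (X in (X < +oo)%E -> _) => aN ineq.
have {}ineq j : ((2 * (`|D j| + j%:R))%:E <= N + (D j)%:E)%E.
  by have := ineq j; rewrite alE -EFinM /c divfK// gt_eqF.
(* The squared norm N is below +oo by hypothesis, and N = -oo contradicts the inequality at j =
   0. *)
case: N aN ineq => [r| |] // _ ineq; last by have := ineq 0%N.
(* At an index m > |r| the inequality would give |D_m| + 2 m <= r. *)
pose m := (Num.truncn `|r|).+1.
have := ineq m; rewrite -EFinD lee_fin => rm.
have h1 : `|r| < m%:R := truncnS_gt `|r|.
have h2 := ler_norm r; have h3 := ler_norm (D m).
have h4 : 0 <= `|D m| by [].
have h5 : 0 <= `|r| by [].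
move: rm h1 h2 h3 h4 h5; move: (m%:R : R) `|D m| `|r| => u v w; lra.
Qed.

End cohomology_classes.

Theorem theorem1p1 (R : realType) (n : nat) :
  exists M : manifold R n,
    [/\ [set: M] !=set0, connected [set: M], oriented M &
        forall (g : metric_field R n) (h : M -> R) (k : nat),
          riemannian M g -> complete_metric M g -> smooth_function h ->
          (k <= n)%N -> k <> 0%N -> k <> n ->
          ~ set_surj (harmonic_space g h k) (deRham_cohomology M k)
                     (natural_map M k)].
Proof.
case: n => [|[|n]].
(* In dimensions 0 and 1 no degree lies strictly between 0 and n, and R^n itself serves. *)
- exists (open_submanifold (@openT 'rV[R]_0) (I : [set: 'rV[R]_0] 0)); split.
  + exact: open_submanifold_nonempty.
  + by apply: connected_open_submanifold; exact: connected_setT_rV.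
  + exact: oriented_open_submanifold.
  + by move=> g h [|k].
- exists (open_submanifold (@openT 'rV[R]_1) (I : [set: 'rV[R]_1] 0)); split.
  + exact: open_submanifold_nonempty.
  + by apply: connected_open_submanifold; exact: connected_setT_rV.
  + exact: oriented_open_submanifold.
  + by move=> g h [|[|k]].
exists (open_submanifold (@open_holes_compl R n) (@holes_compl_nonempty R n)); split.
- exact: open_submanifold_nonempty.
- by apply: connected_open_submanifold; exact: connected_holes_compl.
- exact: oriented_open_submanifold.
move=> g h [|k] // gR _ hs kn _ /eqP kn'.
by apply: natural_map_not_surjective => //; rewrite ltn_neqAle kn' kn.
Qed.
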